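(* Let $R$ be a finitely generated commutative unital $\mathbb{R}$-algebra and let $n$ be a positive integer. For every submodule $N$ of the free $R$-module $R^n$, $$\sqrt[\mathcal{E}]{N}=\sqrt[\mathrm{real}]{N},$$ i.e. the real saturation of $N$ equals the real radical of $N$.
   Context: Let $R$ be a finitely generated commutative unital $\mathbb{R}$-algebra and $M=R^n$ the free $R$-module of rank $n$. Write $V_{\mathbb{R}}(R)$ for the set of all (unital) $\mathbb{R}$-algebra homomorphisms $R\to\mathbb{R}$ (this set may be empty), and let $V_{\mathbb{R}}(M)$ be the set of all pairs $(\phi,\mathbf{u})$ with $\phi\in V_{\mathbb{R}}(R)$ and $\mathbf{u}\in\mathbb{R}^n$. For $\phi\in V_{\mathbb{R}}(R)$ and $\mathbf{h}=(h_1,\ldots,h_n)\in M$, $\phi^n(\mathbf{h})=(\phi(h_1),\ldots,\phi(h_n))\in\mathbb{R}^n$, and $\langle\cdot,\cdot\rangle$ is the standard inner product on $\mathbb{R}^n$, so $\langle\phi^n(\mathbf{h}),\mathbf{u}\rangle=\sum_{i=1}^n\phi(h_i)u_i$. For a submodule $N$ of $M$: (1) The real zero set of $N$ is $Z_{\mathbb{R}}(N)=\{(\phi,\mathbf{u})\in V_{\mathbb{R}}(M) \mid \langle\phi^n(\mathbf{g}),\mathbf{u}\rangle=0 \text{ for every } \mathbf{g}\in N\}$. (2) The real saturation of $N$ is $\sqrt[\mathcal{E}]{N}=\{\mathbf{f}\in M \mid \langle\phi^n(\mathbf{f}),\mathbf{u}\rangle=0 \text{ for all } (\phi,\mathbf{u})\in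 Z_{\mathbb{R}}(N)\}$. (3) $N$ is called real if for every finite family $\mathbf{m}_1,\ldots,\mathbf{m}_K\in M$ such that $\sum_{i=1}^K\mathbf{m}_i\otimes\mathbf{m}_i\in M\otimes N+N\otimes M$ we have $\mathbf{m}_1,\ldots,\mathbf{m}_K\in N$. Here all tensor products are over $R$, and $M\otimes N$ and $N\otimes M$ are considered as submodules of $M\otimes M$. (4) The real radical $\sqrt[\mathrm{real}]{N}$ is the smallest real submodule of $M$ containing $N$ (it always exists). *)

(* Defs.v *)
From HB Require Import structures.
From mathcomp Require Import all_boot all_order all_algebra.
From mathcomp Require Import boolp classical_sets reals.
Set Implicit Arguments.
Unset Strict Implicit.
Unset Printing Implicit Defensive.
Import GRing.Theory.
Local Open Scope classical_set_scope.
Local Open Scope ring_scope.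

(* A commutative unital algebra over a ring R is a commutative ring A with a
   ring morphism iota : R -> A.  The library's comAlgType is not used because
   it excludes the zero algebra. *)

Definition fin_gen_alg (R A : comPzRingType) (iota : {rmorphism R -> A}) :=
  exists s : seq A, forall S : set A,
    subring_closed (mem S) -> range iota `<=` S -> [set` s] `<=` S -> S = setT.

Section Submodules.
Context {A : comPzRingType}.

Definition is_submodule (M : lmodType A) (N : set M) := submod_closed (mem N).

Context {n : nat}.
Implicit Types (u v w : 'rV[A]_n) (N P Q : set 'rV[A]_n).

(* The tensor square of the free module A^n is modelled by n x n matrices,
   with (u (x) v)_ij = u_i v_j; tens_universal is its universal property. *)
Definition tens u v : 'M[A]_n := u^T *m v.

Lemma tensE u v i j : tens u v i j = u 0 i * v 0 j.
Proof. by rewrite !mxE big_ord1 mxE. Qed.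

Lemma tens_bilinear :
  (forall v, linear (tens^~ v)) /\ (forall u, linear (tens u)).
Proof.
split=> [v a u w|u a v w]; apply/matrixP=> i j; rewrite !(tensE, mxE).
  by rewrite mulrDl mulrA.
by rewrite mulrDr mulrCA.
Qed.

Lemma tens_universal (V : lmodType A) (b : 'rV[A]_n -> 'rV[A]_n -> V) :
    (forall v, linear (b^~ v)) -> (forall u, linear (b u)) ->
  exists2 g : {linear 'M[A]_n -> V}, forall u v, g (tens u v) = b u v &
    forall h : {linear 'M[A]_n -> V},
      (forall u v, h (tens u v) = b u v) -> h =1 g.
Proof.
move=> bl br; pose e i : 'rV[A]_n := delta_mx 0 i.
pose g0 (X : 'M[A]_n) := \sum_i \sum_j X i j *: b (e i) (e j).
have g0lin : linear g0.
  move=> a X Y; rewrite /g0 scaler_sumr -big_split; apply: eq_bigr => i _ /=.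
  rewrite scaler_sumr -big_split; apply: eq_bigr => j _ /=.
  by rewrite !mxE scalerDl scalerA.
pose gl : {linear 'M[A]_n -> V} :=
  HB.pack g0 (GRing.isLinear.Build A 'M[A]_n V *:%R g0 g0lin).
have sum_linear (f : {linear 'rV[A]_n -> V}) u :
    f u = \sum_i u 0 i *: f (e i).
  rewrite {1}[u]row_sum_delta linear_sum.
  by apply: eq_bigr => i _; rewrite linearZ.
have sum_lin (f : 'rV[A]_n -> V) : linear f ->
    forall u, f u = \sum_i u 0 i *: f (e i).
  move=> flin; pose fl : {linear 'rV[A]_n -> V} :=
    HB.pack f (GRing.isLinear.Build A 'rV[A]_n V *:%R f flin).
  exact: (sum_linear fl).
have tens_delta i j : tens (e i) (e j) = delta_mx i j.
  by apply/matrixP=> k l; rewrite tensE !mxE eqxx /= -natrM mulnb.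
exists gl => [u v|h hb X].
  rewrite /= /g0 (sum_lin (b^~ v) (bl v)); apply: eq_bigr => i _.
  rewrite (sum_lin (b (e i)) (br (e i))) scaler_sumr; apply: eq_bigr => j _.
  by rewrite scalerA tensE.
rewrite [in LHS](matrix_sum_delta X) linear_sum /= /g0.
apply: eq_bigr => i _; rewrite linear_sum; apply: eq_bigr => j _ /=.
by rewrite linearZ /= -tens_delta hb.
Qed.

(* The image of P (x) Q in the tensor square of A^n.  For P or Q the whole
   module, the map from P (x) Q is injective, since A^n is flat. *)
Definition tens_sub P Q : set 'M[A]_n :=
  [set X | exists2 s : seq ('rV[A]_n * 'rV[A]_n),
    [set` s] `<=` P `*` Q & X = \sum_(p <- s) tens p.1 p.2].

Definition is_real N :=
  forall (k : nat) (m : 'I_k -> 'rV[A]_n),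
    [set X + Y | X in tens_sub setT N & Y in tens_sub N setT]
      (\sum_i tens (m i) (m i)) ->
    forall i, N (m i).

Definition real_submodule_over N P :=
  [/\ is_submodule P, is_real P & N `<=` P].

Definition real_radical N : set 'rV[A]_n :=
  \bigcap_(P in real_submodule_over N) P.

Lemma real_radical_smallest N :
  real_submodule_over N (real_radical N) /\
  (forall P, real_submodule_over N P -> real_radical N `<=` P).
Proof.
split; last by move=> P hP u; apply.
split.
- split=> [|a u v]; rewrite ?inE.
    by move=> P [[P0 _] _ _]; move: P0; rewrite inE.
  move=> hu hv P hP.
  have [[_ Pl] _ _] := hP; have := Pl a u v.
  by rewrite !inE; apply; [exact: hu|exact: hv].
- move=> k m [X [s sN ->] [Y [t tN ->]] XY] i P hP.
  have [_ Preal NP] := hP; apply: Preal; rewrite -XY.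
  exists (\sum_(p <- s) tens p.1 p.2).
    by exists s => // p /sN [? pN]; split=> //; exact: pN.
  exists (\sum_(p <- t) tens p.1 p.2) => //.
  by exists t => // p /tN [pN ?]; split=> //; exact: pN.
- by move=> u Nu P [_ _]; apply.
Qed.

End Submodules.

Section RealSaturation.
Context {R : realType} {A : comPzRingType} (iota : {rmorphism R -> A}).
Context {n : nat}.
Implicit Types (h : 'rV[A]_n) (u : 'rV[R]_n) (N : set 'rV[A]_n).

Definition real_points : set {rmorphism A -> R} :=
  [set phi | cancel iota phi].

(* <phi^n(h), u>; map_mx phi h is phi^n(h). *)
Definition pairing (phi : {rmorphism A -> R}) h u : R :=
  \sum_(i < n) map_mx phi h 0 i * u 0 i.

Definition real_zeros N : set ({rmorphism A -> R} * 'rV[R]_n) :=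
  [set p | real_points p.1 /\ forall g, N g -> pairing p.1 g p.2 = 0].

Definition real_saturation N : set 'rV[A]_n :=
  [set f | forall p, real_zeros N p -> pairing p.1 f p.2 = 0].

End RealSaturation.

(* Main.v *)
Require Import Defs.
From HB Require Import structures.
From mathcomp Require Import all_boot all_order all_algebra.
From mathcomp Require Import generic_quotient ring_quotient fraction.
From mathcomp Require Import closed_field ring zify.
From mathcomp Require Import boolp classical_sets reals.
From mathcomp.multinomials Require Import mpoly.
From mathcomp Require ordered_qelim qe_rcf_th qe_rcf.
Set Implicit Arguments.
Unset Strict Implicit.
Unset Printing Implicit Defensive.
Import Order.TTheory GRing.Theory Num.Theory.
Local Open Scope classical_set_scope.
Local Open Scope ring_scope.

(* For the nontrivial inclusion it is enough to separate: if N is a real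
   submodule and f is not in N, find (phi, u) in Z(N) with <phi^n(f), u> <> 0.
   By Zorn's lemma N may be taken maximal among the real submodules that do not
   contain f.  Then p = (N : f) is a prime ideal with formally real residue
   field K, and reality of N shows that f does not lie in N + p A^n even after
   localizing at p.  So some u in K^n is orthogonal to the image of N but not
   to that of f: this is a zero of N with values in K instead of the reals.

   It is specialized to a real zero by an Artin-Lang argument.  Hilbert's basis
   theorem leaves finitely many polynomial equations; their coefficients and
   the K-valued zero generate a countable ordered subfield of K, which has a
   real closure L inside its algebraic closure (a maximal ordered subfield
   there); and quantifier elimination transfers the solvability of the system
   from L to the reals, its coefficients having the same signs in both. *)

(** * Orderings of fields *)

(** The tensor condition is used in three ways. Scaled by a, it shows that (N : a) is again real,
    which with maximality makes p prime; applied to a family of multiples of f, it makes K formally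
    real; applied to a single multiple of f, it separates f from N + p A^n.

    The field K may be transcendental over the reals, so its zero really has to be moved. In general
    neither of R and L embeds in the other, since L closes only a countable subfield of K;
    countability is what the construction of the algebraic closure starts from. So the coefficients
    of the system cannot remain constants of a formula. They become parameters of a formula with
    rational constants, and R and L are compared through the signs of rational expressions in these
    parameters. The signs agree for every ordering of K: a nonnegative real is a square, hence so is
    its image in K. *)

Lemma Zorn_above T (P : set (set T)) (X0 : set T) : P X0 ->
    (forall F : set (set T), F !=set0 -> F `<=` P -> total_on F subset ->
      P (\bigcup_(X in F) X)) ->
  exists A, [/\ P A, X0 `<=` A & forall B, P B -> A `<=` B -> B `<=` A].
Proof.
(* [Zorn_bigcup] also covers the empty chain, whose union is [set0]; so [set0] is adjoined to the
   family and discarded afterwards. *)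
move=> PX0 Pchain; pose Q A := A = set0 \/ X0 `<=` A /\ P A.
have [F FQ Ftot|A [QA Amax]] := @Zorn_bigcup T Q.
  pose G := F `&` [set A | X0 `<=` A /\ P A].
  have [[A GA]|G0] := pselect (G !=set0); last first.
    left; rewrite -subset0 => x [A FA Ax].
    case: (FQ A FA) => [A0|AP]; first by rewrite A0 in Ax.
    by exfalso; apply: G0; exists A.
  right; have -> : \bigcup_(X in F) X = \bigcup_(X in G) X.
    apply/seteqP; split=> x [B FB Bx]; last by exists B => //; case: FB.
    by exists B => //; split=> //; case: (FQ B FB) => // B0; rewrite B0 in Bx.
  split; first by move=> x X0x; exists A => //; case: GA => _ [+ _]; apply.
  apply: Pchain; first by exists A.
    by move=> B [_ []].
  by move=> B C [FB _] [FC _]; exact: (Ftot B C FB FC).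
have {QA} [X0A PA] : X0 `<=` A /\ P A.
  case: QA => [A0|//]; suff <- : X0 = A by split.
  apply: contrapT => neq; apply: (Amax X0); last by right; split.
  by split; rewrite A0 // => X00; apply: neq; rewrite A0 -subset0.
exists A; split=> // B PB AB; apply: contrapT => nBA.
by apply: (Amax B); [|right; split=> //; apply: subset_trans AB].
Qed.

Section Orderings.
Context {K : fieldType}.
Implicit Types (C E T : set K).

(* The set of nonnegative elements of a total field order on the subfield
   [carrier C] of K. *)
Record ordering C : Prop := Ordering {
  ordering1 : C 1;
  orderingD : forall x y, C x -> C y -> C (x + y);
  orderingM : forall x y, C x -> C y -> C (x * y);
  orderingV : forall x, C x -> C x^-1;
  ordering_anti : forall x, C x -> C (- x) -> x = 0;
  ordering_total : forall x y, C x -> C y -> C (x - y) \/ C (y - x)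
}.

Definition carrier C : set K := [set x | C x \/ C (- x)].

Record subfield E : Prop := Subfield {
  subfield1 : E 1;
  subfieldB : forall x y, E x -> E y -> E (x - y);
  subfieldM : forall x y, E x -> E y -> E (x * y);
  subfieldV : forall x, E x -> E x^-1
}.

Record preordering E T : Prop := Preordering {
  preordering_sub : T `<=` E;
  preorderingD : forall x y, T x -> T y -> T (x + y);
  preorderingM : forall x y, T x -> T y -> T (x * y);
  preordering_sqr : forall x, E x -> T (x ^+ 2);
  preorderingN1 : ~ T (- 1)
}.

Lemma subfield0 E : subfield E -> E 0.
Proof. by case=> E1 EB _ _; rewrite -(subrr 1); apply: EB. Qed.

Lemma subfieldN E x : subfield E -> E x -> E (- x).
Proof. by move=> sE Ex; rewrite -sub0r; apply: subfieldB => //; apply: subfield0. Qed.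

Lemma carrier_subfield C : ordering C -> subfield (carrier C).
Proof.
move=> oC; split.
- by left; apply: ordering1.
- move=> x y [Cx|Cx] [Cy|Cy].
  + by case: (ordering_total oC Cx Cy) => ?; [left|right; rewrite opprB].
  + by left; apply: (orderingD oC).
  + by right; rewrite opprB addrC -[- x + y]/(- x + y) addrC; apply: (orderingD oC).
  + case: (ordering_total oC Cx Cy) => h; [right|left]; move: h.
      by rewrite opprK opprB addrC.
    by rewrite opprK addrC.
- move=> x y [Cx|Cx] [Cy|Cy]; [left|right|right|left].
  + exact: (orderingM oC).
  + by rewrite -mulrN; apply: (orderingM oC).
  + by rewrite -mulNr; apply: (orderingM oC).
  + by rewrite -mulrNN; apply: (orderingM oC).
- by move=> x [Cx|Cx]; [left|right; rewrite -invrN]; apply: orderingV.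
Qed.

Lemma ordering_sqr C x : ordering C -> carrier C x -> C (x ^+ 2).
Proof.
move=> oC [Cx|Cx]; last rewrite -sqrrN; rewrite expr2; exact: (orderingM oC).
Qed.

Lemma preordering1 E T : subfield E -> preordering E T -> T 1.
Proof.
move=> sE pT; rewrite -(expr1n _ 2).
exact: (preordering_sqr pT (subfield1 sE)).
Qed.

Lemma preordering0 E T : subfield E -> preordering E T -> T 0.
Proof.
move=> sE pT; rewrite (_ : 0 = 0 ^+ 2); last by rewrite expr0n.
exact: (preordering_sqr pT (subfield0 sE)).
Qed.

Lemma preorderingV E T x : subfield E -> preordering E T -> T x -> T x^-1.
Proof.
move=> sE pT Tx; have [->|x0] := eqVneq x 0.
  by rewrite invr0; apply: preordering0 pT.
rewrite -[x^-1]mul1r -(mulfV x0) -mulrA -expr2; apply: (preorderingM pT) => //.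
by apply: (preordering_sqr pT); apply: subfieldV => //; apply: preordering_sub Tx.
Qed.

(** For x in E outside T, the set T - xT is again a preordering: from -1 = a - x b would follow x =
    (1 + a) b (1/b)^2, an element of T. Maximality then puts -x in T. *)
Lemma maximal_preordering E T : subfield E -> preordering E T ->
    (forall T', preordering E T' -> T `<=` T' -> T' `<=` T) ->
  ordering T /\ E `<=` carrier T.
Proof.
move=> sE pT maxT; have T0 := preordering0 sE pT; have T1 := preordering1 sE pT.
have total x : E x -> T x \/ T (- x).
  move=> Ex; have [?|nTx] := pselect (T x); [by left|right].
  pose T' := [set z | exists a b, [/\ T a, T b & z = a - x * b]].
  apply: (maxT T'); last by exists 0, 1; rewrite mulr1 sub0r.
    split.
    - move=> _ [a [b [Ta Tb ->]]]; apply: subfieldB => //.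
        exact: preordering_sub Ta.
      by apply: subfieldM => //; apply: preordering_sub Tb.
    - move=> _ _ [a [b [Ta Tb ->]]] [c [d [Tc Td ->]]].
      exists (a + c), (b + d); split; try exact: (preorderingD pT).
      by rewrite mulrDr opprD addrACA.
    - move=> _ _ [a [b [Ta Tb ->]]] [c [d [Tc Td ->]]].
      exists (a * c + x ^+ 2 * (b * d)), (a * d + b * c); split.
      + apply: (preorderingD pT); apply: (preorderingM pT) => //.
          exact: (preordering_sqr pT).
        exact: (preorderingM pT).
      + by apply: (preorderingD pT); apply: (preorderingM pT).
      + ring.
    - by move=> y Ey; exists (y ^+ 2), 0; rewrite mulr0 subr0; split=> //;
        apply: (preordering_sqr pT).
    - move=> [a [b [Ta Tb e]]]; have xb : x * b = 1 + a.
        by rewrite -[1]opprK e; ring.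
      have b0 : b != 0.
        apply/eqP => b0; apply: (preorderingN1 pT).
        by move: e; rewrite b0 mulr0 subr0 => ->.
      apply: nTx; have -> : x = (1 + a) * (b * b^-1 ^+ 2) by rewrite -xb; field.
      apply: (preorderingM pT); first exact: (preorderingD pT).
      apply: (preorderingM pT) => //; apply: (preordering_sqr pT).
      by apply: subfieldV => //; apply: preordering_sub Tb.
  by move=> a Ta; exists a, 0; rewrite mulr0 subr0.
split; last by move=> x Ex; apply: total.
split=> //; [exact: preorderingD pT|exact: preorderingM pT| | |].
- by move=> x; apply: preorderingV pT.
- move=> x Tx TNx; apply/eqP; apply: contrapT => /negP x0.
  apply: (preorderingN1 pT); have -> : -1 = - x * (x * x^-1 ^+ 2) by field.
  apply: (preorderingM pT) => //; apply: (preorderingM pT) => //.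
  by apply: (preordering_sqr pT); apply: subfieldV => //; apply: preordering_sub Tx.
- move=> x y Tx Ty; rewrite -[y - x]opprB; apply: total.
  by apply: subfieldB => //; apply: (preordering_sub pT).
Qed.

Lemma ordering_extension E T : subfield E -> preordering E T ->
  exists C, [/\ ordering C, T `<=` C & carrier C = E].
Proof.
move=> sE pT; have [//|F [A0 FA0] FP Ftot|C [pC TC Cmax]] :=
    @Zorn_above _ (preordering E) T.
  split.
  - by move=> x [A FA]; apply: preordering_sub; apply: FP.
  - move=> x y [A FA Ax] [B FB By].
    case: (Ftot A B FA FB) => AB; [exists B|exists A] => //;
      by apply: (preorderingD (FP _ _)) => //; apply: AB.
  - move=> x y [A FA Ax] [B FB By].
    case: (Ftot A B FA FB) => AB; [exists B|exists A] => //;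
      by apply: (preorderingM (FP _ _)) => //; apply: AB.
  - by move=> x Ex; exists A0 => //; apply: (preordering_sqr (FP _ FA0)).
  - by move=> [A FA]; apply: (preorderingN1 (FP _ FA)).
have [oC EC] := maximal_preordering sE pC Cmax.
exists C; split=> //; apply/seteqP; split=> // x [Cx|Cx].
  exact: (preordering_sub pC).
by rewrite -[x]opprK; apply: subfieldN => //; apply: (preordering_sub pC).
Qed.

(** Here the carrier is not fixed: inclusion of the nonnegative elements extends both the subfield
    and its order, so a maximal [C] is a maximal ordered subfield of K. *)
Lemma maximal_ordering C0 : ordering C0 -> exists C, [/\ ordering C,
  C0 `<=` C & forall D, ordering D -> C `<=` D -> D `<=` C].
Proof.
move=> oC0; apply: Zorn_above => // F [A0 FA0] FP Ftot; split.
- by exists A0 => //; apply: ordering1; apply: FP.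
- move=> x y [A FA Ax] [B FB By].
  case: (Ftot A B FA FB) => AB; [exists B|exists A] => //;
    by apply: (orderingD (FP _ _)) => //; apply: AB.
- move=> x y [A FA Ax] [B FB By].
  case: (Ftot A B FA FB) => AB; [exists B|exists A] => //;
    by apply: (orderingM (FP _ _)) => //; apply: AB.
- by move=> x [A FA Ax]; exists A => //; apply: (orderingV (FP _ FA)).
- move=> x [A FA Ax] [B FB By].
  case: (Ftot A B FA FB) => AB; [apply: (ordering_anti (FP _ FB))|
    apply: (ordering_anti (FP _ FA))] => //; exact: AB.
- move=> x y [A FA Ax] [B FB By].
  case: (Ftot A B FA FB) => AB.
    by case: (ordering_total (FP _ FB) (AB _ Ax) By) => ?; [left|right]; exists B.
  by case: (ordering_total (FP _ FA) Ax (AB _ By)) => ?; [left|right]; exists A.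
Qed.

End Orderings.

(** * Subfields and ordered subfields as types *)

Section SubfieldType.
Context {K : fieldType} {E : set K} (sE : subfield E).

(** The proof of [subfield E] is kept as an argument so that the closure instance, which depends on
    it, can be inferred from the predicate. *)
Definition subfield_pred of subfield E : pred K := fun x => `[< E x >].

Fact subfield_pred_divring_closed : divring_closed (subfield_pred sE).
Proof.
split.
- exact/asboolP/(subfield1 sE).
- by move=> x y /asboolP Ex /asboolP Ey; apply/asboolP/(subfieldB sE).
- move=> x y /asboolP Ex /asboolP Ey; apply/asboolP/(subfieldM sE) => //.
  exact: (subfieldV sE).
Qed.

HB.instance Definition _ := GRing.isDivringClosed.Build K (subfield_pred sE)
  subfield_pred_divring_closed.

Record subfield_type := SubfieldType {
  sfval : K; _ : sfval \in subfield_pred sE }.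

HB.instance Definition _ := [isSub for sfval].
HB.instance Definition _ := [Choice of subfield_type by <:].
HB.instance Definition _ :=
  [SubChoice_isSubIntegralDomain of subfield_type by <:].
HB.instance Definition _ :=
  [SubIntegralDomain_isSubField of subfield_type by <:].

Lemma sfvalP (x : subfield_type) : E (val x).
Proof. exact/asboolP/(valP x). Qed.

Definition in_subfield x (Ex : E x) : subfield_type :=
  SubfieldType (introT (asboolP _) Ex).

End SubfieldType.

Section OrderedSubfield.
Context {K : fieldType} {C : set K} (oC : ordering C).

Definition ordered_subfield := subfield_type (carrier_subfield oC).
Local Notation L := ordered_subfield.

HB.instance Definition _ := SubType.on L.
HB.instance Definition _ := GRing.Field.on L.

Definition osf_le (x y : L) : bool := `[< C (val y - val x) >].
Definition osf_norm (x : L) : L := if osf_le 0 x then x else - x.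

Lemma osf_le0E (x : L) : osf_le 0 x = `[< C (val x) >].
Proof. by rewrite /osf_le rmorph0 subr0. Qed.

Fact osf_le0_add (x y : L) : osf_le 0 x -> osf_le 0 y -> osf_le 0 (x + y).
Proof.
rewrite !osf_le0E => /asboolP Cx /asboolP Cy.
by apply/asboolP; rewrite rmorphD; apply: orderingD.
Qed.

Fact osf_le0_mul (x y : L) : osf_le 0 x -> osf_le 0 y -> osf_le 0 (x * y).
Proof.
rewrite !osf_le0E => /asboolP Cx /asboolP Cy.
by apply/asboolP; rewrite rmorphM; apply: orderingM.
Qed.

Fact osf_le0_anti (x : L) : osf_le 0 x -> osf_le x 0 -> x = 0.
Proof.
rewrite osf_le0E /osf_le rmorph0 sub0r => /asboolP Cx /asboolP CNx.
by apply: val_inj; rewrite rmorph0; apply: (ordering_anti oC).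
Qed.

Fact osf_sub_ge0 (x y : L) : osf_le 0 (y - x) = osf_le x y.
Proof. by rewrite osf_le0E rmorphB. Qed.

Fact osf_le0_total (x : L) : osf_le 0 x || osf_le x 0.
Proof.
rewrite osf_le0E /osf_le rmorph0 sub0r; apply/orP.
by case: (sfvalP x) => ?; [left|right]; apply/asboolP.
Qed.

Fact osf_normN (x : L) : osf_norm (- x) = osf_norm x.
Proof.
have h : osf_le 0 (- x) = osf_le x 0 by rewrite -(osf_sub_ge0 x) sub0r.
rewrite /osf_norm h opprK; case: (boolP (osf_le 0 x)) => [x0|nx0]; last first.
  by move: (osf_le0_total x); rewrite (negbTE nx0) /= => ->.
by case: ifP => // x0'; rewrite (osf_le0_anti x0 x0') oppr0.
Qed.

Fact osf_ge0_norm (x : L) : osf_le 0 x -> osf_norm x = x.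
Proof. by rewrite /osf_norm => ->. Qed.

HB.instance Definition _ := Num.IntegralDomain_isLeReal.Build L
  osf_le0_add osf_le0_mul osf_le0_anti osf_sub_ge0 osf_le0_total
  osf_normN osf_ge0_norm (fun _ _ => erefl).

Lemma osf_ge0P (x : L) : reflect (C (val x)) (0 <= x).
Proof. by rewrite [0 <= x]osf_le0E; apply: asboolP. Qed.

End OrderedSubfield.

(** * Real closure *)

Section MaximalOrdering.
Context {K : closedFieldType} {C : set K} (oC : ordering C).
Context (maxC : forall D, ordering D -> C `<=` D -> D `<=` C).
Local Notation L := (ordered_subfield oC).
Local Notation "p ^v" := (map_poly (val : L -> K) p) (at level 2, format "p ^v").

(* If [p] has least size among the polynomials that change sign between a and b
   but have no root in L, then adjoining a root [z] of [p] keeps the sums of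
   terms c q(z)^2, with c >= 0, away from -1: modulo [p] such a relation reads
   1 + sum c q^2 = p h with h shorter than [p] and also changing sign, so h has
   a root in L, which is absurd.  Hence the order extends to L(z), against the
   maximality of [C]. *)
Section MinimalCounterexample.
Context (p : {poly L}) (a b : L).
Context (pab : p.[a] * p.[b] < 0).
Context (IHp : forall q : {poly L}, (size q < size p)%N ->
  q.[a] * q.[b] < 0 -> exists x, root q x).
Context (p_noroot : forall x, ~~ root p x).
Context (z : K) (pz : root p^v z).

Lemma mc_neq0 : p != 0.
Proof. by apply: contraTneq pab => ->; rewrite !horner0 mul0r ltxx. Qed.

(** In a proper factorization both factors are shorter than [p] and have no root in L, so by [IHp]
    neither changes sign between a and b; then neither would [p]. *)
Lemma mc_irreducible g : g %| p -> size g = 1%N \/ p %| g.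
Proof.
move=> gp; have [g1|g1] := eqVneq (size g) 1%N; [by left|right].
have g0 : g != 0 by apply: contraNneq mc_neq0 => g0; rewrite g0 dvd0p in gp.
have [//|npg] := boolP (p %| g); exfalso.
have gltp : (size g < size p)%N.
  rewrite ltn_neqAle (dvdp_leq mc_neq0 gp) andbT; apply: contra npg => e.
  by move: e; rewrite (dvdp_size_eqp gp) => /andP[].
have := gp; rewrite dvdp_eq => /eqP; set h := p %/ g => ph.
have h0 : h != 0 by apply: contraNneq mc_neq0 => h0; rewrite ph h0 mul0r.
have hltp : (size h < size p)%N.
  rewrite [in ltnRHS]ph size_mul //.
  move: (g0) (h0); rewrite -!size_poly_gt0 => g0' h0'.
  by move: g1 g0' h0'; move: (size g) (size h) => m k; lia.
have hp : h %| p by rewrite ph dvdp_mulr.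
have rootN q : q %| p -> (size q < size p)%N -> 0 <= q.[a] * q.[b].
  move=> qp qlt; rewrite leNgt; apply/negP => qab.
  have [x qx] := IHp qlt qab.
  by have := p_noroot x; rewrite (root_dvdp qp).
move: pab; rewrite ph !hornerM mulrACA ltNge mulr_ge0 //; exact: rootN.
Qed.

Lemma mc_dvdp q : root q^v z = (p %| q).
Proof.
apply/idP/idP => [qz|pq]; last by apply: root_dvdp pz; rewrite dvdp_map.
have [g1|] := mc_irreducible (dvdp_gcdl p q); last first.
  by move=> /dvdp_trans; apply; apply: dvdp_gcdr.
have : coprimep p^v q^v by rewrite coprimep_map /coprimep g1.
by move=> /coprimep_root - /(_ z pz); rewrite (rootP qz) eqxx.
Qed.

Lemma mc_inv q : exists r, r^v.[z] = (q^v.[z])^-1.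
Proof.
have [qz0|qz0] := eqVneq q^v.[z] 0.
  by exists 0; rewrite qz0 invr0 rmorph0 horner0.
have [g1|pg] := mc_irreducible (dvdp_gcdl p q); last first.
  have : root q^v z by rewrite mc_dvdp (dvdp_trans pg) // dvdp_gcdr.
  by move/rootP => qz; rewrite qz eqxx in qz0.
have /Bezout_eq1_coprimepP[[u w] /= uw] : coprimep p q by rewrite /coprimep g1.
exists w; apply: (mulIf qz0); rewrite mulVf //.
have := congr1 (fun r : {poly L} => r^v.[z]) uw.
by rewrite rmorphD !rmorphM rmorph1 !hornerE (rootP pz) mulr0 add0r.
Qed.

Definition mc_field : set K := [set y | exists q, y = q^v.[z]].

Lemma mc_subfield : subfield mc_field.
Proof.
split.
- by exists 1; rewrite rmorph1 hornerC.
- by move=> _ _ [q ->] [r ->]; exists (q - r); rewrite rmorphB !hornerE.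
- by move=> _ _ [q ->] [r ->]; exists (q * r); rewrite rmorphM hornerM.
- by move=> _ [q ->]; have [r rq] := mc_inv q; exists r.
Qed.

Definition mc_term (x : L * {poly L}) : K := val x.1 * (x.2^v.[z]) ^+ 2.

Lemma mc_termE x : (x.1 *: x.2 ^+ 2)^v.[z] = mc_term x.
Proof. by rewrite map_polyZ hornerZ rmorphXn horner_exp. Qed.

(** This is the preordering of L(z) generated by [C]. *)
Definition mc_cone : set K := [set y | exists s : seq (L * {poly L}),
  all (fun x => 0 <= x.1) s /\ y = \sum_(x <- s) mc_term x].

Lemma mc_coneN1 : ~ mc_cone (-1).
Proof.
move=> [s [s0 es]].
have pN1 : (1 < size p)%N.
  rewrite ltnNge; apply/negP => /size1_polyC pc; move: pab.
  by rewrite pc !hornerC ltNge -expr2 sqr_ge0.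
(* Reduction modulo [p] keeps the value at [z], where [h] vanishes, and bounds the size of [h] by 2
   size p - 3. The cofactor [q] below then has size at most size p - 2. *)
pose h := 1 + \sum_(x <- s) x.1 *: (x.2 %% p) ^+ 2.
have hx x : 0 < h.[x].
  rewrite !hornerE ltr_wpDr // horner_sum big_seq sumr_ge0 // => y ys.
  by rewrite hornerZ horner_exp mulr_ge0 ?sqr_ge0 // (allP s0).
have hs : (size h <= (size p + size p).-2.-1)%N.
  rewrite (leq_trans (size_polyD _ _)) // geq_max size_poly1; apply/andP; split.
    by move: pN1; move: (size p) => m; lia.
  apply: (leq_trans (size_sum _ _ _)).
  apply/bigmax_leqP_seq => y ys _; apply: (leq_trans (size_scale_leq _ _)).
  rewrite expr2; apply: (leq_trans (size_polyMleq _ _)).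
  by move: (ltn_modpN0 y.2 mc_neq0); move: (size (y.2 %% p)) (size p) => m k; lia.
have hz : root h^v z.
  apply/rootP; rewrite rmorphD rmorph1 rmorph_sum !hornerE horner_sum.
  suff -> : \sum_(x <- s) (x.1 *: (x.2 %% p) ^+ 2)^v.[z] =
            \sum_(x <- s) mc_term x by rewrite -es subrr.
  apply: eq_bigr => y _; rewrite (mc_termE (y.1, _)) /mc_term.
  suff -> : (y.1, y.2 %% p).2^v.[z] = y.2^v.[z] by [].
  rewrite [in RHS](divp_eq y.2 p) rmorphD rmorphM !hornerE.
  by rewrite (rootP pz) mulr0 add0r.
move: hz; rewrite mc_dvdp dvdp_eq => /eqP; set q := h %/ p => hq.
have q0 : q != 0.
  by apply/eqP => q0; have := hx 0; rewrite hq q0 mul0r horner0 ltxx.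
have qp : (size q < size p)%N.
  move: hs; rewrite hq size_mul ?mc_neq0 //.
  rewrite -size_poly_gt0 in q0; move: pN1 q0; move: (size q) (size p) => m k; lia.
(* [h] is positive at a and b while [p] changes sign there, so [q] changes sign too. *)
have [x /rootP qx] : exists x, root q x.
  apply: IHp => //; rewrite -(ltr_nM2l pab) mulr0.
  suff -> : p.[a] * p.[b] * (q.[a] * q.[b]) = h.[a] * h.[b] by rewrite mulr_gt0.
  by rewrite hq !hornerM mulrACA ![q.[_] * _]mulrC.
by have := hx x; rewrite hq hornerM qx mul0r ltxx.
Qed.

Lemma mc_preordering : preordering mc_field mc_cone.
Proof.
split; last exact: mc_coneN1.
- move=> _ [s [_ ->]]; exists (\sum_(x <- s) x.1 *: x.2 ^+ 2).
  rewrite rmorph_sum horner_sum; apply: eq_bigr => x _.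
  by rewrite -mc_termE.
- move=> _ _ [s [s0 ->]] [t [t0 ->]]; exists (s ++ t).
  by rewrite all_cat s0 t0 big_cat.
- move=> _ _ [s [s0 ->]] [t [t0 ->]].
  exists [seq (x.1 * y.1, x.2 * y.2) | x <- s, y <- t]; split.
    apply/allP => _ /allpairsP[[x y] /= [xs yt ->]] /=.
    by rewrite mulr_ge0 ?(allP s0 _ xs) ?(allP t0 _ yt).
  rewrite big_distrlr big_allpairs_dep; apply: eq_bigr => x _ /=.
  apply: eq_bigr => y _; rewrite [RHS]/mc_term.
  have -> : (x.1 * y.1, x.2 * y.2).2^v.[z] = x.2^v.[z] * y.2^v.[z].
    by rewrite rmorphM hornerM.
  by rewrite rmorphM exprMn mulrACA.
- move=> _ [q ->]; exists [:: (1, q)]; split; first by rewrite /= ler01.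
  by rewrite big_seq1 /mc_term rmorph1 mul1r.
Qed.

Lemma mc_false : False.
Proof.
have [D [oD TD DE]] := ordering_extension mc_subfield mc_preordering.
have CD : C `<=` D.
  move=> x Cx; apply: TD; have Lx : carrier C x by left.
  exists [:: (in_subfield (carrier_subfield oC) Lx, 1)]; split.
    by rewrite /= andbT; apply/osf_ge0P.
  by rewrite big_seq1 /mc_term rmorph1 hornerC expr1n mulr1.
have DC := maxC oD CD.
have : carrier D z by rewrite DE; exists 'X; rewrite map_polyX hornerX.
have {}DC : carrier D `<=` carrier C by move=> x [Dx|Dx]; [left|right]; apply: DC.
move=> /DC Cz; have := p_noroot (in_subfield (carrier_subfield oC) Cz).
by rewrite -(fmorph_root (val : L -> K)) pz.
Qed.

End MinimalCounterexample.

Lemma sign_change_root (p : {poly L}) a b : p.[a] * p.[b] < 0 ->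
  exists x, root p x.
Proof.
have [n] := ubnP (size p); elim: n p => // n IHn p pn pab.
apply: contrapT => nroot.
have p_noroot x : ~~ root p x by apply/negP => px; apply: nroot; exists x.
have [|z pz] := @closed_rootP _ (p^v) _.
  rewrite size_map_poly; apply/negP => /eqP p1; move: pab.
  by rewrite [p]size1_polyC ?p1 // !hornerC ltNge -expr2 sqr_ge0.
apply: (mc_false pab _ p_noroot pz) => q qp qab.
by apply: IHn qab; apply: leq_trans qp _.
Qed.

(** A root x given by [sign_change_root] may lie outside [a, b]. In that case X - x has constant
    sign on [a, b], so the quotient by it, or its opposite when x > b, inherits the sign change and
    has smaller size. *)
Lemma real_closed_ordered_subfield : Num.real_closed_axiom L.
Proof.
move=> p a b ab; have [n] := ubnP (size p); elim: n p => // n IHn p pn.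
case/andP; rewrite le_eqVlt => /predU1P[pa _|pa].
  by exists a; rewrite ?lexx ?ab //; apply/rootP.
rewrite le_eqVlt => /predU1P[/esym pb|pb].
  by exists b; rewrite ?lexx ?ab //; apply/rootP.
have [x px] : exists x, root p x.
  by apply: (@sign_change_root p a b); rewrite nmulr_rlt0.
have [/andP[ax xb]|nx] := boolP (a <= x <= b); first by exists x; rewrite ?ax.
have p0 : p != 0 by apply: contraTneq pa => ->; rewrite horner0 ltxx.
move: (px); rewrite -dvdp_XsubCl dvdp_eq => /eqP; set q := p %/ _ => pq.
have qn : (size q < n)%N.
  rewrite size_divp ?polyXsubC_eq0 // size_XsubC subn1.
  by move: p0 pn; rewrite -size_poly_gt0; move: (size p) => m; lia.
have qroot r : root q r -> root p r by move=> qr; rewrite pq rootM qr.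
have {}pq r : p.[r] = q.[r] * (r - x) by rewrite {1}pq !hornerE.
move: nx; rewrite negb_and -!ltNge => /orP[xa|bx].
  have [|r rab qr] := IHn q qn; last by exists r => //; apply: qroot.
    move: pa pb; rewrite !pq; have := lt_le_trans xa ab.
    rewrite -subr_gt0 => bx; rewrite -subr_gt0 in xa.
    by rewrite pmulr_llt0 // pmulr_lgt0 // => /ltW -> /ltW ->.
have [||r rab qr] := IHn (- q); first by rewrite size_polyN.
  move: pa pb; rewrite !pq; have := le_lt_trans ab bx.
  rewrite -subr_lt0 => ax; rewrite -subr_lt0 in bx.
  by rewrite nmulr_llt0 // nmulr_lgt0 // !hornerN oppr_le0 oppr_ge0 => /ltW -> /ltW ->.
by exists r => //; apply: qroot; rewrite -rootN.
Qed.

End MaximalOrdering.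

Lemma ordering_image (K L : fieldType) (f : {rmorphism K -> L}) (P : set K) :
  ordering P -> ordering [set f x | x in P].
Proof.
move=> oP; split.
- by exists 1; [apply: ordering1|rewrite rmorph1].
- move=> _ _ [x Px <-] [y Py <-]; exists (x + y); last exact: rmorphD.
  exact: orderingD.
- move=> _ _ [x Px <-] [y Py <-]; exists (x * y); last exact: rmorphM.
  exact: orderingM.
- by move=> _ [x Px <-]; exists x^-1; [apply: orderingV|rewrite fmorphV].
- move=> _ [x Px <-] [y Py fxy].
  have yx : y = - x by apply: (fmorph_inj f); rewrite fxy rmorphN.
  by rewrite (ordering_anti oP Px) ?rmorph0 // -yx.
- move=> _ _ [x Px <-] [y Py <-].
  by case: (ordering_total oP Px Py) => ?; [left; exists (x - y)|
    right; exists (y - x)]; rewrite ?rmorphB.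
Qed.

Lemma real_closure (K : countFieldType) (P : set K) :
    ordering P -> carrier P = setT ->
  exists (L : rcfType) (f : {rmorphism K -> L}), forall x, P x -> 0 <= f x.
Proof.
move=> oP PT; have [W [f _]] := countable_algebraic_closure K.
have [C [oC fPC maxC]] := maximal_ordering (ordering_image f oP).
pose L : rcfType := HB.pack (ordered_subfield oC)
  (Num.RealField_isClosed.Build _ (real_closed_ordered_subfield maxC)).
have fC x : carrier C (f x).
  have : carrier P x by rewrite PT.
  by case=> Px; [left|right; rewrite -rmorphN]; apply: fPC; [exists x|exists (- x)].
pose g x : L := in_subfield (carrier_subfield oC) (fC x).
have gB : zmod_morphism g by move=> x y; apply: val_inj; rewrite /= rmorphB.
have gM : monoid_morphism g.
  by split=> [|x y]; apply: val_inj; rewrite /= ?rmorph1 ?rmorphM.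
pose h : {rmorphism K -> L} := HB.pack g
  (GRing.isZmodMorphism.Build K L g gB) (GRing.isMonoidMorphism.Build K L g gM).
by exists L, h => x Px; apply/osf_ge0P; apply: fPC; exists x.
Qed.

(** * Finitely generated subfields are countable *)

Section CountableSubfield.
Context {K : fieldType} (e : seq K).

(** Trees encode expressions in the entries of [e], with labels 0, 1, 2 for difference, product and
    inverse; all other trees denote 1. Trees over nat form a countable type, hence so do their
    values. *)
Fixpoint tree_eval (t : GenTree.tree nat) : K :=
  match t with
  | GenTree.Leaf i => e`_i
  | GenTree.Node 0 [:: u; v] => tree_eval u - tree_eval v
  | GenTree.Node 1 [:: u; v] => tree_eval u * tree_eval v
  | GenTree.Node 2 [:: u] => (tree_eval u)^-1
  | _ => 1
  end.

Definition generated : set K := range tree_eval.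

Lemma generated_subfield : subfield generated.
Proof.
split.
- by exists (GenTree.Node 0 [::]).
- by move=> _ _ [t _ <-] [u _ <-]; exists (GenTree.Node 0 [:: t; u]).
- by move=> _ _ [t _ <-] [u _ <-]; exists (GenTree.Node 1 [:: t; u]).
- by move=> _ [t _ <-]; exists (GenTree.Node 2 [:: t]).
Qed.

Lemma generated_mem x : x \in e -> generated x.
Proof.
by move=> xe; exists (GenTree.Leaf (index x e)) => //=; rewrite nth_index.
Qed.

(** Choosing one expression for each element injects the subfield into the trees. *)
Definition generated_code (x : subfield_type generated_subfield) :=
  projT1 (cid2 (sfvalP x)).

Definition generated_decode (t : GenTree.tree nat) :
    subfield_type generated_subfield :=
  in_subfield generated_subfield (imageT tree_eval t).

Lemma generated_codeK : cancel generated_code generated_decode.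
Proof.
by move=> x; apply: val_inj; rewrite /generated_code; case: cid2.
Qed.

Definition countable_subfield : countFieldType :=
  HB.pack (subfield_type generated_subfield) (CanIsCountable generated_codeK).

End CountableSubfield.

Definition formally_real (K : fieldType) :=
  forall s : seq K, \sum_(x <- s) x ^+ 2 <> -1.

Lemma formally_real_ordering (K : fieldType) : formally_real K ->
  exists P : set K, ordering P /\ carrier P = setT.
Proof.
move=> realK; pose T := [set y : K | exists s, y = \sum_(x <- s) x ^+ 2].
have [||P [oP _ PT]] := @ordering_extension K setT T; last by exists P.
  by [].
split=> //; last by move=> [s /esym]; apply: realK.
- by move=> _ _ [s ->] [t ->]; exists (s ++ t); rewrite big_cat.
- move=> _ _ [s ->] [t ->]; exists [seq x * y | x <- s, y <- t].
  rewrite big_distrlr big_allpairs_dep; apply: eq_bigr => x _ /=.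
  by apply: eq_bigr => y _; rewrite exprMn.
- by move=> x _; exists [:: x]; rewrite big_seq1.
Qed.

(** * Transfer between real closed fields *)

Section QuantifierElimination.
Import ordered_qelim qe_rcf_th qe_rcf.

Section MapConstants.
Context {T T' : Type} (f : T -> T').

(** Elimination runs separately over R and over L. Its outputs are comparable because both are the
    image under [ratr] of its output over the rationals, which requires every stage of the procedure
    to commute with a change of constants. *)
Fixpoint map_gterm (t : GRing.term T) : GRing.term T' :=
  match t with
  | GRing.Var i => GRing.Var _ i
  | GRing.Const a => GRing.Const (f a)
  | GRing.NatConst n => GRing.NatConst _ n
  | GRing.Add u v => GRing.Add (map_gterm u) (map_gterm v)
  | GRing.Opp u => GRing.Opp (map_gterm u)
  | GRing.NatMul u n => GRing.NatMul (map_gterm u) n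
  | GRing.Mul u v => GRing.Mul (map_gterm u) (map_gterm v)
  | GRing.Inv u => GRing.Inv (map_gterm u)
  | GRing.Exp u n => GRing.Exp (map_gterm u) n
  end.

Fixpoint map_oform (p : ord.formula T) : ord.formula T' :=
  match p with
  | ord.Bool b => ord.Bool b
  | ord.Equal t u => ord.Equal (map_gterm t) (map_gterm u)
  | ord.Lt t u => ord.Lt (map_gterm t) (map_gterm u)
  | ord.Le t u => ord.Le (map_gterm t) (map_gterm u)
  | ord.Unit t => ord.Unit (map_gterm t)
  | ord.And p q => ord.And (map_oform p) (map_oform q)
  | ord.Or p q => ord.Or (map_oform p) (map_oform q)
  | ord.Implies p q => ord.Implies (map_oform p) (map_oform q)
  | ord.Not p => ord.Not (map_oform p)
  | ord.Exists i p => ord.Exists i (map_oform p)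
  | ord.Forall i p => ord.Forall i (map_oform p)
  end.

(** The elimination of one quantifier works in a second syntax, with no inverse in terms and no
    quantifier in formulas. *)
Fixpoint map_term (t : term T) : term T' :=
  match t with
  | Var i => Var _ i
  | Const a => Const (f a)
  | NatConst n => NatConst _ n
  | Add u v => Add (map_term u) (map_term v)
  | Opp u => Opp (map_term u)
  | NatMul u n => NatMul (map_term u) n
  | Mul u v => Mul (map_term u) (map_term v)
  | Exp u n => Exp (map_term u) n
  end.

Fixpoint map_form (p : formula T) : formula T' :=
  match p with
  | Bool b => Bool b
  | Equal t u => Equal (map_term t) (map_term u)
  | Lt t u => Lt (map_term t) (map_term u)
  | Le t u => Le (map_term t) (map_term u)
  | And p q => And (map_form p) (map_form q)
  | Or p q => Or (map_form p) (map_form q)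
  | Implies p q => Implies (map_form p) (map_form q)
  | Not p => Not (map_form p)
  end.

End MapConstants.

(** * Quantifier elimination commutes with a change of constants *)

Section MapFormula.
Context {F F' : realFieldType} (f : {rmorphism F -> F'}).
Local Notation map_gterm := (map_gterm f).
Local Notation map_oform := (map_oform f).
Local Notation map_term := (map_term f).
Local Notation map_form := (map_form f).

Lemma map_gterm_rterm t : rterm_to_term (map_term t) = map_gterm t.
Proof. by elim: t => //= [t -> u ->|t ->|t -> n|t -> u ->|t -> n]. Qed.

Lemma map_oform_qfr p : qfr_to_formula (map_form p) = map_oform p.
Proof.
by elim: p => //= [t u|t u|t u|p -> q ->|p -> q ->|p -> q ->|p ->];
  rewrite ?map_gterm_rterm.
Qed.

Lemma map_to_rterm t : to_rterm (map_gterm t) = map_term (to_rterm t).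
Proof. by elim: t => //= [t -> u ->|t ->|t -> n|t -> u ->|t -> n]. Qed.

Notation fF := (formula F).
Notation fF' := (formula F').
Notation mp := (map map_term).

(* A procedure in continuation-passing style commutes with the change of
   constants as soon as its continuations do. *)
Definition cps_map T T' (g : T -> T') (k : T -> fF) (k' : T' -> fF') :=
  forall x, map_form (k x) = k' (g x).

Lemma map_Size p k k' : cps_map id k k' ->
  map_form (Size p k) = Size (mp p) k'.
Proof.
elim: p k k' => [|c p IHp] k k' kk' /=; first exact: kk'.
by apply: IHp => -[|n] /=; rewrite /If /= ?kk'.
Qed.

Lemma map_Isnull p k k' : cps_map id k k' ->
  map_form (Isnull p k) = Isnull (mp p) k'.
Proof. by move=> kk'; apply: map_Size => n; apply: kk'. Qed.

Lemma map_LtSize p q k k' : cps_map id k k' ->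
  map_form (LtSize p q k) = LtSize (mp p) (mp q) k'.
Proof. by move=> kk'; apply: map_Size => n; apply: map_Size => m; apply: kk'. Qed.

Lemma map_LeadCoef p k k' : cps_map map_term k k' ->
  map_form (LeadCoef p k) = LeadCoef (mp p) k'.
Proof.
elim: p k k' => [|c p IHp] k k' kk' /=; first by rewrite kk' /= rmorph0.
by apply: IHp => l; rewrite /If /= !kk'.
Qed.

Lemma map_AmulXn a n : mp (AmulXn a n) = AmulXn (map_term a) n.
Proof. by elim: n => //= n ->; rewrite rmorph0. Qed.

Lemma map_AddPoly p q : mp (AddPoly p q) = AddPoly (mp p) (mp q).
Proof. by elim: p q => [|a p IHp] [|b q] //=; rewrite IHp. Qed.

Lemma map_ScalPoly c p : mp (ScalPoly c p) = ScalPoly (map_term c) (mp p).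
Proof. by rewrite /ScalPoly -!map_comp. Qed.

Lemma map_MulPoly p q : mp (MulPoly p q) = MulPoly (mp p) (mp q).
Proof. by elim: p => //= a p IHp; rewrite map_AddPoly map_ScalPoly /= IHp. Qed.

Lemma map_ExpPoly p n : mp (ExpPoly p n) = ExpPoly (mp p) n.
Proof.
case: n => // n; rewrite /ExpPoly !iteropS.
by elim: n => //= n IHn; rewrite map_MulPoly IHn.
Qed.

Lemma map_OppPoly p : mp (OppPoly p) = OppPoly (mp p).
Proof. by rewrite /OppPoly map_ScalPoly /= rmorphN1. Qed.

Lemma map_NatMulPoly n p : mp (NatMulPoly n p) = NatMulPoly n (mp p).
Proof. by rewrite /NatMulPoly map_ScalPoly. Qed.

Lemma map_Deriv p : mp (Deriv p) = Deriv (mp p).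
Proof. by elim: p => //= a p IHp; rewrite map_AddPoly /= IHp. Qed.

Lemma map_Rediv_rec_loop q sq cq c qq r n k k' :
    cps_map (fun d => (d.1.1, mp d.1.2, mp d.2)%PAIR) k k' ->
  map_form (Rediv_rec_loop q sq cq c qq r n k) =
  Rediv_rec_loop (mp q) sq (map_term cq) c (mp qq) (mp r) n k'.
Proof.
move=> kk'; elim: n c qq r => [|n IHn] c qq r /=; apply: map_Size => sr /=;
  case: ifP => _; rewrite ?kk' //=; apply: map_LeadCoef => lr /=.
  rewrite kk' /= !map_AddPoly !map_MulPoly map_AmulXn map_OppPoly.
  by rewrite map_MulPoly map_AmulXn.
rewrite IHn /= !map_AddPoly !map_MulPoly map_AmulXn map_OppPoly.
by rewrite map_MulPoly map_AmulXn.
Qed.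

Lemma map_Rediv p q k k' :
    cps_map (fun d => (d.1.1, mp d.1.2, mp d.2)%PAIR) k k' ->
  map_form (Rediv p q k) = Rediv (mp p) (mp q) k'.
Proof.
move=> kk'; apply: map_Isnull => -[] /=; first by rewrite kk' /= rmorph0.
apply: map_Size => sq; apply: map_Size => sp; apply: map_LeadCoef => lq /=.
by rewrite (map_Rediv_rec_loop _ _ _ _ _ _ _ kk') /= rmorph0.
Qed.

Lemma map_Rmod p q k k' : cps_map mp k k' ->
  map_form (Rmod p q k) = Rmod (mp p) (mp q) k'.
Proof. by move=> kk'; apply: map_Rediv => d; rewrite kk'. Qed.

Lemma map_Rscal p q k k' : cps_map id k k' ->
  map_form (Rscal p q k) = Rscal (mp p) (mp q) k'.
Proof. by move=> kk'; apply: map_Rediv => d; rewrite kk'. Qed.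

Lemma map_Rgcd_loop n p q k k' : cps_map mp k k' ->
  map_form (Rgcd_loop n p q k) = Rgcd_loop n (mp p) (mp q) k'.
Proof.
elim: n p q k k' => [|n IHn] p q k k' kk' /=; apply: map_Rmod => r;
  apply: map_Isnull => -[] /=; rewrite ?kk' //.
exact: IHn.
Qed.

Lemma map_Rgcd p q k k' : cps_map mp k k' ->
  map_form (Rgcd p q k) = Rgcd (mp p) (mp q) k'.
Proof.
move=> kk'; apply: map_LtSize => -[] /=; apply: map_Isnull => -[] /=;
  rewrite ?kk' //; apply: map_Size => n; exact: map_Rgcd_loop.
Qed.

Lemma map_BigRgcd ps k k' : cps_map mp k k' ->
  map_form (BigRgcd ps k) = BigRgcd (map mp ps) k'.
Proof.
elim: ps k k' => [|p ps IHps] k k' kk' /=; first by rewrite kk' /= rmorph0.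
by apply: IHps => r; apply: map_Rgcd.
Qed.

Lemma map_Changes s k k' : cps_map id k k' ->
  map_form (Changes s k) = Changes (mp s) k'.
Proof.
elim: s k k' => [|a s IHs] k k' kk' /=; first exact: kk'.
by apply: IHs => n; rewrite /If /= !kk'; case: s.
Qed.

Lemma map_SeqPInfty ps k k' : cps_map mp k k' ->
  map_form (SeqPInfty ps k) = SeqPInfty (map mp ps) k'.
Proof.
elim: ps k k' => [|p ps IHps] k k' kk' /=; first exact: kk'.
by apply: map_LeadCoef => l; apply: IHps => s; apply: kk'.
Qed.

Lemma map_SeqMInfty ps k k' : cps_map mp k k' ->
  map_form (SeqMInfty ps k) = SeqMInfty (map mp ps) k'.
Proof.
elim: ps k k' => [|p ps IHps] k k' kk' /=; first exact: kk'.
apply: map_LeadCoef => l; apply: map_Size => n; apply: IHps => s.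
by rewrite kk' /= rmorphN1.
Qed.

Lemma map_ChangesPoly ps k k' : cps_map id k k' ->
  map_form (ChangesPoly ps k) = ChangesPoly (map mp ps) k'.
Proof.
move=> kk'; apply: map_SeqMInfty => m; apply: map_SeqPInfty => p.
by apply: map_Changes => vm; apply: map_Changes => vp; apply: kk'.
Qed.

Lemma map_NextMod p q k k' : cps_map mp k k' ->
  map_form (NextMod p q k) = NextMod (mp p) (mp q) k'.
Proof.
move=> kk'; apply: map_LeadCoef => l; apply: map_Rscal => n.
by apply: map_Rmod => r; rewrite kk' map_ScalPoly.
Qed.

Lemma map_ModsAux p q n k k' : cps_map (map mp) k k' ->
  map_form (ModsAux p q n k) = ModsAux (mp p) (mp q) n k'.
Proof.
elim: n p q k k' => [|n IHn] p q k k' kk' /=; first exact: kk'.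
apply: map_Isnull => -[]; first exact: kk'.
by apply: map_NextMod => r; apply: IHn => s; apply: kk'.
Qed.

Lemma map_Mods p q k k' : cps_map (map mp) k k' ->
  map_form (Mods p q k) = Mods (mp p) (mp q) k'.
Proof.
by move=> kk'; apply: map_Size => n; apply: map_Size => m; apply: map_ModsAux.
Qed.

Lemma map_nth_mp (s : seq (polyF F)) i : mp (nth [::] s i) = nth [::] (map mp s) i.
Proof.
have [lis|lsi] := ltnP i (size s); first by rewrite (nth_map [::]).
by rewrite !nth_default ?size_map.
Qed.

Lemma map_PolyComb sq sc : mp (PolyComb sq sc) = PolyComb (map mp sq) sc.
Proof.
rewrite /PolyComb /reducebig size_map; elim: (iota _ _) => //= i s <-.
by rewrite map_MulPoly map_ExpPoly map_nth_mp.
Qed.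

Lemma map_Pcq sq i : mp (Pcq sq i) = Pcq (map mp sq) i.
Proof.
rewrite /Pcq map_nth_mp size_map -map_comp; congr nth.
by apply: eq_map => sc /=; rewrite map_PolyComb.
Qed.

Lemma map_TaqR p q k k' : cps_map id k k' ->
  map_form (TaqR p q k) = TaqR (mp p) (mp q) k'.
Proof.
move=> kk'; rewrite /TaqR /bind_def -map_Deriv -map_MulPoly.
by apply: map_Mods => r; apply: map_ChangesPoly.
Qed.

Lemma map_TaqsR p sq i k k' : cps_map map_term k k' ->
  map_form (TaqsR p sq i k) = TaqsR (mp p) (map mp sq) i k'.
Proof.
move=> kk'; rewrite /TaqsR /bind_def -map_Pcq.
by apply: map_TaqR => n; rewrite kk' /= rmorph_int.
Qed.

Lemma map_BoundingPoly sq : mp (BoundingPoly sq) = BoundingPoly (map mp sq).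
Proof.
rewrite /BoundingPoly map_Deriv; congr Deriv; rewrite /reducebig.
by elim: sq => //= q sq <-; rewrite map_MulPoly.
Qed.

(** These constants come from the inverse of an integer matrix, so they are rational and preserved
    by [f]. *)
Lemma map_coefs n i : f (coefs F n i) = coefs F' n i.
Proof.
have [lti|lei] := ltnP i (3 ^ n); last first.
  by rewrite /coefs !nth_default ?rmorph0 ?size_map -?enumT ?size_enum_ord.
rewrite /coefs !(nth_map (Ordinal lti)) -?enumT ?size_enum_ord // !castmxE.
set a := cast_ord _ _; set b := cast_ord _ _.
have -> : invmx (map_mx intr (ctmat n)) =
    map_mx f (invmx (map_mx intr (ctmat n))) :> 'M[F']_(3 ^ n).
  rewrite map_invmx -map_mx_comp; congr invmx; apply: eq_map_mx => x /=.
  by rewrite rmorph_int.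
by rewrite mxE.
Qed.

Lemma map_Coefs n i : map_term (Coefs F n i) = Coefs F' n i.
Proof.
case: n => [|[|n]] /=; congr Const; rewrite ?map_coefs ?rmorph_nat //.
by case: i => [|[|[|i]]] /=; rewrite ?nth_nil ?rmorph0 ?fmorphV ?rmorph_nat.
Qed.

Lemma map_CcountWeak p sq k k' : cps_map map_term k k' ->
  map_form (CcountWeak p sq k) = CcountWeak (mp p) (map mp sq) k'.
Proof.
move=> kk'; rewrite /CcountWeak size_map.
(* The accumulator of the loop is generalized from 0 to any term; for this the 0 on the right is
   first seen as the image of the one on the left. *)
rewrite -[0%qfT in RHS]/(map_term 0%qfT); move: (_ ^ _)%N 0%qfT => n.
elim: n => [|n IHn] s //=.
by apply: map_TaqsR => x; rewrite -map_Coefs; apply: IHn.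
Qed.

Lemma map_CcountGt0 sp sq :
  map_form (CcountGt0 sp sq) = CcountGt0 (map mp sp) (map mp sq).
Proof.
apply: map_BigRgcd => p; apply: map_Isnull => -[] /=; last first.
  by apply: map_CcountWeak.
rewrite /bind_def -map_BoundingPoly; apply: map_CcountWeak => c /=.
congr (Or _ (Or _ _)); rewrite /reducebig.
  by elim: sq => //= q s ->; congr And; apply: map_LeadCoef.
elim: sq => //= q s ->; congr And; apply: map_Size => n.
by apply: map_LeadCoef.
Qed.

Lemma map_abstrX i t : mp (abstrX i t) = abstrX i (map_term t).
Proof.
elim: t => //= [n|t IHt u IHu|t IHt|t IHt n|t IHt u IHu|t IHt n].
- by case: ifP.
- by rewrite map_AddPoly IHt IHu.
- by rewrite map_OppPoly IHt.
- by rewrite map_NatMulPoly IHt.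
- by rewrite map_MulPoly IHt IHu.
- by rewrite map_ExpPoly IHt.
Qed.

Lemma map_wproj n s :
  map_oform (wproj n s) = wproj n (map map_gterm s.1, map map_gterm s.2)%PAIR.
Proof.
rewrite -map_oform_qfr map_CcountGt0; congr (qfr_to_formula (CcountGt0 _ _));
  by rewrite /= -!map_comp; apply: eq_map => t /=;
     rewrite map_abstrX map_to_rterm.
Qed.

Definition map_oclause (c : ord.oclause F) : ord.oclause F' :=
  let: ord.Oclause a b c d := c in
  ord.Oclause (map map_gterm a) (map map_gterm b)
              (map map_gterm c) (map map_gterm d).

Lemma map_and_odnf c1 c2 :
  map map_oclause (ord.and_odnf c1 c2) =
  ord.and_odnf (map map_oclause c1) (map map_oclause c2).
Proof.
rewrite /ord.and_odnf; elim: c1 => [|a c1 IHc]; first by rewrite !big_nil.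
rewrite /= !big_cons map_cat IHc; congr cat; rewrite -!map_comp.
by apply: eq_map => -[? ? ? ?]; case: a => ? ? ? ? /=; rewrite !map_cat.
Qed.

Lemma map_qf_to_odnf p b :
  map map_oclause (ord.qf_to_odnf p b) = ord.qf_to_odnf (map_oform p) b.
Proof.
elim: p b => //= [a|t u|t u|t u|t|p IHp q IHq|p IHp q IHq|p IHp q IHq|i p _|i p _];
  by case=> //=; rewrite ?map_cat ?map_and_odnf ?IHp ?IHq //; case: a.
Qed.

Lemma map_leq_elim_aux a b c :
  map (fun x => (map map_gterm x.1, map map_gterm x.2)%PAIR)
      (ord.leq_elim_aux a b c) =
  ord.leq_elim_aux (map map_gterm a) (map map_gterm b) (map map_gterm c).
Proof.
by elim: c => //= t c <-; rewrite map_cat -!map_comp.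
Qed.

Lemma map_neq_elim_aux a b :
  map (map map_gterm) (ord.neq_elim_aux a b) =
  ord.neq_elim_aux (map map_gterm a) (map map_gterm b).
Proof. by elim: b => //= t b <-; rewrite map_cat -!map_comp. Qed.

Lemma map_oclause_to_w c :
  map (fun x => (map map_gterm x.1, map map_gterm x.2)%PAIR)
      (ord.oclause_to_w c) = ord.oclause_to_w (map_oclause c).
Proof.
case: c => a b c d; rewrite /ord.oclause_to_w /ord.oclause_neq_leq_elim /=.
rewrite -map_leq_elim_aux; elim: (ord.leq_elim_aux _ _ _) => //= x s IHs.
rewrite !map_cat IHs; congr cat; rewrite -map_neq_elim_aux.
by rewrite -!map_comp; apply: eq_map.
Qed.

Lemma map_proj n c :
  map_oform (ord.proj (@wproj F) n c) = ord.proj (@wproj F') n (map_oclause c).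
Proof.
rewrite /ord.proj -map_oclause_to_w; elim: (ord.oclause_to_w c) => //= x s ->.
by rewrite map_wproj.
Qed.

Lemma map_quantifier_elim p :
  map_oform (ord.quantifier_elim (@wproj F) p) =
  ord.quantifier_elim (@wproj F') (map_oform p).
Proof.
have elim_aux n q : map_oform (foldr (@ord.Or F) (ord.Bool false)
      (map (ord.proj (@wproj F) n) (ord.qf_to_odnf q false))) =
    foldr (@ord.Or F') (ord.Bool false)
      (map (ord.proj (@wproj F') n) (ord.qf_to_odnf (map_oform q) false)).
  rewrite -map_qf_to_odnf; elim: (ord.qf_to_odnf _ _) => //= c s ->.
  by rewrite map_proj.
elim: p => //= [p -> q ->|p -> q ->|p -> q ->|p ->|n p IHp|n p IHp] //.
  by rewrite -IHp; apply: elim_aux.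
(* A universal quantifier is eliminated as the negation of an existential one. *)
by rewrite -IHp; congr ord.Not; apply: (elim_aux n (ord.Not _)).
Qed.

End MapFormula.

Local Notation qmap_term R := (map_gterm (@ratr R)).
Local Notation qmap_form R := (map_oform (@ratr R)).

Lemma eval_qmap (K L : fieldType) (f : {rmorphism K -> L}) e t :
  GRing.eval (map f e) (qmap_term L t) = f (GRing.eval e (qmap_term K t)).
Proof.
elim: t => //= [i|a|n|t -> u ->|t ->|t -> n|t -> u ->|t ->|t -> n].
- have [ie|ei] := ltnP i (size e); first by rewrite (nth_map 0).
  by rewrite !nth_default ?size_map ?rmorph0.
- by rewrite fmorph_rat.
- by rewrite rmorph_nat.
- by rewrite rmorphD.
- by rewrite rmorphN.
- by rewrite rmorphMn.
- by rewrite rmorphM.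
- by rewrite fmorphV.
- by rewrite rmorphXn.
Qed.

(** * Transfer of formulas with parameters *)

Section Transfer.
Context {R1 R2 : rcfType} (e1 : seq R1) (e2 : seq R2).
Context (e12 : forall t, (0 <= GRing.eval e1 (qmap_term R1 t)) =
                         (0 <= GRing.eval e2 (qmap_term R2 t))).

Lemma qf_eval_transfer p :
  ord.qf_eval e1 (qmap_form R1 p) = ord.qf_eval e2 (qmap_form R2 p).
Proof.
have le12 t u :
    (GRing.eval e1 (qmap_term R1 t) <= GRing.eval e1 (qmap_term R1 u)) =
    (GRing.eval e2 (qmap_term R2 t) <= GRing.eval e2 (qmap_term R2 u)).
  by have := e12 (GRing.Add u (GRing.Opp t)); rewrite /= !subr_ge0.
elim: p => //= [t u|t u|t|p -> q ->|p -> q ->|p -> q ->|p ->] //.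
- by rewrite !eq_le !le12.
- by rewrite !ltNge le12.
- have := le12 t (GRing.NatConst _ 0); have := le12 (GRing.NatConst _ 0) t.
  by rewrite !unitfE !eq_le /= => -> ->.
Qed.

Lemma rterm_map (F F' : realFieldType) (f : F -> F') t :
  GRing.rterm (map_gterm f t) = GRing.rterm t.
Proof. by elim: t => //= t -> u ->. Qed.

Lemma rformula_map (F F' : realFieldType) (f : F -> F') p :
  ord.rformula (map_oform f p) = ord.rformula p.
Proof.
by elim: p => //= [t u|t u|t u|p -> q ->|p -> q ->|p -> q ->];
  rewrite ?rterm_map.
Qed.

(** Over both fields, elimination yields the image of one quantifier-free rational formula, whose
    atoms are decided by the signs compared in [e12]. *)
Lemma holds_transfer p : ord.rformula p ->
  ord.holds e1 (qmap_form R1 p) <-> ord.holds e2 (qmap_form R2 p).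
Proof.
move=> rp; have qeP (R : rcfType) e : reflect (ord.holds e (qmap_form R p))
    (ord.qf_eval e (ord.quantifier_elim (@wproj R) (qmap_form R p))).
  apply: ord.quantifier_elim_rformP; rewrite ?rformula_map //.
    exact: wf_QE_wproj.
  exact: valid_QE_wproj.
have qe12 := qf_eval_transfer (ord.quantifier_elim (@wproj _) p).
rewrite !map_quantifier_elim in qe12.
by split=> /qeP h; apply/qeP; rewrite ?qe12 // -qe12.
Qed.

End Transfer.

Lemma holds_foldExists (R : rcfType) (e : seq R) I p :
  ord.holds e (foldr (@ord.Exists R) p I) <->
  exists2 e', {in [predC I], forall i, e'`_i = e`_i} & ord.holds e' p.
Proof.
elim: I e => /= [|i I IHi] e.
  by split=> [|[e' ee' /ord.eq_holds]]; [exists e|apply=> i; rewrite ee'].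
split=> [[x /IHi[e' ee' pe']]|[e' ee' pe']].
  exists e' => // k; rewrite !inE negb_or => /andP[ki kI].
  by rewrite ee' // nth_set_nth /= (negbTE ki).
exists e'`_i; apply/IHi; exists e' => // k kI; rewrite nth_set_nth /=.
by case: eqVneq => [->//|ki]; rewrite ee' // !inE negb_or ki.
Qed.

(** * Polynomial systems as formulas *)

Section MpolyTerm.
Context {R : rcfType} {n : nat} (cs : seq R).

(* [cs] lists the coefficients; they become the variables n, n + 1, ... of a
   term without constants. *)
Definition monom_term (m : 'X_{1..n}) : GRing.term rat :=
  foldr (fun i => GRing.Mul (GRing.Exp (GRing.Var _ (i : 'I_n)) (m i)))
        (GRing.NatConst _ 1) (index_enum 'I_n).

Definition mpoly_term (F : {mpoly R[n]}) : GRing.term rat :=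
  foldr (fun m => GRing.Add (GRing.Mul
            (GRing.Var _ (n + index F@_m cs)) (monom_term m)))
        (GRing.NatConst _ 0) (msupp F).

Lemma eval_monom_term (K : fieldType) (e : seq K) m :
  GRing.eval e (qmap_term K (monom_term m)) = \prod_(i < n) e`_i ^+ m i.
Proof.
rewrite /monom_term; elim: (index_enum _) => [|i s IHs] /=.
  by rewrite big_nil.
by rewrite big_cons IHs.
Qed.

Lemma eval_mpoly_term (K : fieldType) (e : seq K) F :
  GRing.eval e (qmap_term K (mpoly_term F)) =
  \sum_(m <- msupp F) e`_(n + index F@_m cs) * \prod_(i < n) e`_i ^+ m i.
Proof.
rewrite /mpoly_term; elim: (msupp F) => [|m s IHs] /=; first by rewrite big_nil.
by rewrite big_cons IHs eval_monom_term.
Qed.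

Lemma rterm_mpoly_term F : GRing.rterm (mpoly_term F).
Proof.
rewrite /mpoly_term; elim: (msupp F) => //= m s ->; rewrite andbT.
by rewrite /monom_term; elim: (index_enum _).
Qed.

Lemma eval_mpoly_term_mmap (K : fieldType) (j : {rmorphism R -> K})
    (z : 'I_n -> K) (e : seq K) F :
    (forall i : 'I_n, e`_i = z i) ->
    {in msupp F, forall m, e`_(n + index F@_m cs) = j F@_m} ->
  GRing.eval e (qmap_term K (mpoly_term F)) = mmap j z F.
Proof.
move=> ez ej; rewrite eval_mpoly_term /mmap big_seq [RHS]big_seq.
apply: eq_bigr => m mF; rewrite ej //; congr (_ * _).
by apply: eq_bigr => i _; rewrite ez.
Qed.

End MpolyTerm.

Definition system_formula (G : GRing.term rat) (Fs : seq (GRing.term rat)) :=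
  foldr (fun F => ord.And (ord.Equal F (GRing.NatConst _ 0)))
        (ord.Not (ord.Equal G (GRing.NatConst _ 0))) Fs.

Lemma holds_system (R : rcfType) (e : seq R) G Fs :
  ord.holds e (qmap_form R (system_formula G Fs)) <->
  GRing.eval e (qmap_term R G) != 0 /\
  all (fun F => GRing.eval e (qmap_term R F) == 0) Fs.
Proof.
elim: Fs => /= [|F Fs IHFs]; first by split=> [/eqP|[/eqP]].
rewrite IHFs; split=> [[/eqP -> [-> ->]]//|[-> /andP[/eqP -> ->]]//].
Qed.

Lemma rformula_system G Fs : GRing.rterm G -> all (@GRing.rterm rat) Fs ->
  ord.rformula (system_formula G Fs).
Proof.
by move=> rG; elim: Fs => /= [_|F Fs IHFs /andP[-> /IHFs ->]]; rewrite ?rG.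
Qed.

Lemma map_foldExists (F F' : realFieldType) (f : F -> F') p I :
  map_oform f (foldr (@ord.Exists F) p I) =
  foldr (@ord.Exists F') (map_oform f p) I.
Proof. by elim: I => //= i I ->. Qed.

Lemma rformula_foldExists (F : realFieldType) (p : ord.formula F) I :
  ord.rformula (foldr (@ord.Exists F) p I) = ord.rformula p.
Proof. by elim: I. Qed.

Section ArtinLangFinite.
Context {R : rcfType} {K : fieldType} (j : {rmorphism R -> K}).
Context (realK : formally_real K) {n : nat} (z : 'I_n -> K).

Lemma artin_lang_finite (G : {mpoly R[n]}) (Fs : seq {mpoly R[n]}) :
    mmap j z G != 0 -> all (fun F => mmap j z F == 0) Fs ->
  exists x : 'I_n -> R,
    mmap idfun x G != 0 /\ all (fun F => mmap idfun x F == 0) Fs.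
Proof.
move=> Gz Fz.
pose cs := flatten [seq [seq F@_m | m <- msupp F] | F : {mpoly R[n]} <- G :: Fs].
have cs_mem F m : F \in G :: Fs -> m \in msupp F -> F@_m \in cs.
  by move=> FG mF; apply/flatten_mapP; exists F => //; apply: map_f.
(* [eK] follows the numbering of variables in [mpoly_term]: the coordinates of the zero, then the
   coefficients from index n on. *)
clearbody cs; pose zs := codom z; pose eK := zs ++ map j cs.
have szs : size zs = n by rewrite size_codom card_ord.
pose K0 := countable_subfield eK; pose v : {rmorphism K0 -> K} := val.
have [P [oP PT]] := formally_real_ordering realK.
have [e0 e0K] : exists e0 : seq K0, map v e0 = eK.
  have : all (fun x => `[< exists x0 : K0, v x0 = x >]) eK.
    apply/allP => x /generated_mem ex.
    by apply/asboolP; exists (in_subfield (generated_subfield eK) ex).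
  elim: (eK) => [_|x s IHs /= /andP[/asboolP[x0 x0x] /IHs[s0 s0s]]].
    by exists [::].
  by exists (x0 :: s0); rewrite /= x0x s0s.
pose Q : set K0 := [set x | P (v x)].
have QE x : Q x = P (v x) by [].
have oQ : ordering Q.
  split=> [|x y Px Py|x y Px Py|x Px|x Px PNx|x y Px Py]; rewrite ?QE.
  - by rewrite rmorph1; apply: ordering1.
  - by rewrite rmorphD; apply: orderingD.
  - by rewrite rmorphM; apply: orderingM.
  - by rewrite fmorphV; apply: orderingV.
  - apply: (fmorph_inj v); rewrite rmorph0; apply: (ordering_anti oP) => //.
  - by rewrite !rmorphB; apply: (ordering_total oP).
have QT : carrier Q = setT.
  apply/seteqP; split=> // x _.
  have : carrier P (v x) by rewrite PT.
  by rewrite /carrier /= !QE rmorphN.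
have [L [f f_ge0]] := real_closure oQ QT.
(* The first n variables are bound in [phi]; the zeros only hold their places, so that the
   parameters start at index n. *)
pose eR := nseq n 0 ++ cs; pose e0R := nseq n 0 ++ drop n e0.
have e0RK : map v e0R = map j eR.
  by rewrite !map_cat !map_nseq !rmorph0 map_drop e0K /eK drop_size_cat.
pose eL := map f e0R.
have sgnRL t : (0 <= GRing.eval eR (qmap_term R t)) =
               (0 <= GRing.eval eL (qmap_term L t)).
  rewrite /eL eval_qmap; set r := GRing.eval _ _; set w := GRing.eval _ _.
  have vw : v w = j r by rewrite -!eval_qmap e0RK.
  (* A nonnegative r' is the square of its square root, so its image in K lies in every ordering.
     The converse follows by applying this to -r and using injectivity to exclude f w = 0. *)
  have pos (r' : R) (w' : K0) : v w' = j r' -> 0 <= r' -> 0 <= f w'.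
    move=> vw' r0; apply: f_ge0; rewrite QE vw' -(sqr_sqrtr r0) rmorphXn.
    by apply: ordering_sqr; rewrite ?PT.
  have [r0|r0] := leP 0 r; first by rewrite (pos _ _ vw r0).
  have := pos (- r) (- w); rewrite !rmorphN vw oppr_ge0 => /(_ erefl (ltW r0)).
  rewrite oppr_ge0 le_eqVlt => /predU1P[fw0|fw]; last by rewrite leNgt fw.
  have w0 : w = 0 by apply: (fmorph_inj f); rewrite fw0 rmorph0.
  move: r0; have /eqP := vw; rewrite w0 rmorph0 eq_sym fmorph_eq0 => /eqP ->.
  by rewrite ltxx.
pose phi := foldr (@ord.Exists rat) (system_formula (mpoly_term cs G)
  (map (mpoly_term cs) Fs)) (iota 0 n).
have rphi : ord.rformula phi.
  rewrite rformula_foldExists; apply: rformula_system.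
    exact: rterm_mpoly_term.
  by rewrite all_map; apply/allP => F _; apply: rterm_mpoly_term.
have evL F : F \in G :: Fs ->
    mmap j z F = v (GRing.eval e0 (qmap_term K0 (mpoly_term cs F))).
  move=> FG; rewrite -eval_qmap e0K; apply/esym/eval_mpoly_term_mmap.
    move=> i; rewrite nth_cat szs ltn_ord /zs (nth_map i) ?size_enum_ord //.
    by rewrite nth_ord_enum.
  move=> m mF; rewrite nth_cat szs ltnNge leq_addr /= addKn.
  by rewrite (nth_map 0) ?index_mem ?nth_index // (cs_mem F).
have : ord.holds eL (qmap_form L phi).
  (* In L the quantifiers of [phi] are witnessed by the given zero, read in [K0] and mapped by
     [f]. *)
  rewrite map_foldExists; apply/holds_foldExists; exists (map f e0).
    move=> i; rewrite !inE mem_iota /= add0n -leqNgt => ni.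
    have [ie|ei] := ltnP i (size e0); last first.
      rewrite !nth_default ?size_map // size_cat size_nseq size_drop.
      by move: ei ni; move: (size e0) => k; lia.
    have ie' : (i < size e0R)%N.
      by rewrite size_cat size_nseq size_drop subnKC ?(leq_trans ni) ?(ltnW ie).
    rewrite !(nth_map 0) // /e0R nth_cat size_nseq ltnNge ni /= nth_drop.
    by rewrite subnKC.
  apply/holds_system; split.
    by rewrite eval_qmap fmorph_eq0; move: Gz; rewrite evL ?mem_head // fmorph_eq0.
  rewrite all_map; apply/allP => F FF /=; rewrite eval_qmap fmorph_eq0.
  by move: (allP Fz F FF); rewrite evL ?inE ?FF ?orbT // fmorph_eq0.
move=> /(holds_transfer sgnRL rphi); rewrite map_foldExists.
move=> /holds_foldExists[e ee /holds_system[Ge Fe]].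
pose x (i : 'I_n) := e`_i.
have evR F : F \in G :: Fs ->
    GRing.eval e (qmap_term R (mpoly_term cs F)) = mmap idfun x F.
  move=> FG; apply: eval_mpoly_term_mmap => // m mF.
  rewrite ee; last by rewrite !inE mem_iota /= add0n -leqNgt leq_addr.
  rewrite nth_cat size_nseq ltnNge leq_addr /= addKn nth_index //.
  exact: (cs_mem F).
exists x; rewrite -evR ?mem_head //; split=> //.
apply/allP => F FF; rewrite -evR ?inE ?FF ?orbT //.
by move: Fe; rewrite all_map => /allP /(_ F FF).
Qed.

End ArtinLangFinite.

End QuantifierElimination.

(** * Hilbert's basis theorem *)

Record ideal (A : comNzRingType) (I : set A) : Prop := Ideal {
  ideal0 : I 0;
  idealD : forall x y, I x -> I y -> I (x + y);
  idealMl : forall a x, I x -> I (a * x)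
}.

Lemma idealB (A : comNzRingType) (I : set A) x y :
  ideal I -> I x -> I y -> I (x - y).
Proof.
move=> idI Ix Iy; apply: (idealD idI) => //.
by rewrite -mulN1r; apply: (idealMl idI).
Qed.

(** Generation by [s] is expressed through minimality among ideals, which avoids explicit linear
    combinations. *)
Definition noetherian (A : comNzRingType) := forall I : set A, ideal I ->
  exists s : seq A, [set` s] `<=` I /\
    forall J, ideal J -> [set` s] `<=` J -> I `<=` J.

Lemma noetherian_field (F : fieldType) : noetherian F.
Proof.
move=> I idI; have [[x [Ix x0]]|I0] := pselect (exists x, I x /\ x != 0).
  exists [:: x]; split=> [y /=|J idJ sJ y _]; first by rewrite inE => /eqP ->.
  rewrite -(divfK x0 y); apply: (idealMl idJ); apply: sJ.
  by rewrite /= mem_head.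
exists [::]; split=> // J idJ _ x Ix; have [->|x0] := eqVneq x 0.
  exact: (ideal0 idJ).
by exfalso; apply: I0; exists x.
Qed.

Lemma noetherian_surj (A B : comNzRingType) (f : {rmorphism A -> B}) :
  (forall y, exists x, f x = y) -> noetherian A -> noetherian B.
Proof.
move=> fsurj nA I idI.
have pre (J : set B) : ideal J -> ideal (f @^-1` J).
  move=> idJ; split; rewrite /preimage /=; first by rewrite rmorph0; apply: ideal0.
    by move=> x y; rewrite rmorphD; apply: idealD.
  by move=> a x; rewrite rmorphM; apply: idealMl.
have [s [sI sJ]] := nA _ (pre I idI).
exists (map f s); split=> [_ /mapP[x xs ->]|J idJ sJ' y]; first exact: sI.
have [x <-] := fsurj y; apply: (sJ _ (pre J idJ)) => z zs.
by apply: sJ' => /=; apply: map_f.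
Qed.

Section HilbertBasis.
Context {A : comNzRingType} (nA : noetherian A).
Implicit Types (I J : set {poly A}).

(** The size bound allows the coefficient of degree d to vanish: these are the leading coefficients
    in degree d together with 0, which makes them an ideal. *)
Definition lead_ideal I d : set A :=
  [set b | exists p, [/\ I p, (size p <= d.+1)%N & p`_d = b]].

Lemma lead_ideal_ideal I d : ideal I -> ideal (lead_ideal I d).
Proof.
move=> idI; split.
- by exists 0; rewrite size_poly0 coef0; split=> //; apply: ideal0.
- move=> _ _ [p [Ip sp <-]] [q [Iq sq <-]]; exists (p + q).
  rewrite coefD; split=> //; first exact: (idealD idI).
  by rewrite (leq_trans (size_polyD _ _)) // geq_max sp.
- move=> a _ [p [Ip sp <-]]; exists (a%:P * p).
  rewrite coefCM; split=> //; first exact: (idealMl idI).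
  by rewrite mul_polyC (leq_trans (size_scale_leq _ _)).
Qed.

Lemma lead_idealS I d e : ideal I -> (d <= e)%N ->
  lead_ideal I d `<=` lead_ideal I e.
Proof.
move=> idI de _ [p [Ip sp <-]]; exists ('X^(e - d) * p).
split; first exact: (idealMl idI).
  rewrite mulrC; have [->|p0] := eqVneq p 0; first by rewrite mul0r size_poly0.
  by rewrite size_mulXn // -(subnK de) addnK -addnS leq_add2l.
by rewrite mulrC coefMXn ltnNge leq_subr /= subKn.
Qed.

(** [t] lifts generators of the leading ideal. If J contains [t], these generators belong to the
    leading ideal of J [&] I, hence so does the leading coefficient of p. *)
Lemma lead_ideal_lift I d : ideal I -> exists t : seq {poly A},
  [set` t] `<=` I /\ forall J, ideal J -> [set` t] `<=` J -> forall p,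
    I p -> (size p <= d.+1)%N ->
    exists q, [/\ J q, I q, (size q <= d.+1)%N & q`_d = p`_d].
Proof.
move=> idI; have [s [sI sJ]] := nA (lead_ideal_ideal d idI).
have [t [tI ts]] : exists t : seq {poly A}, [set` t] `<=` I /\
    forall b, b \in s -> exists2 p, p \in t & (size p <= d.+1)%N /\ p`_d = b.
  elim: (s) sI => [|b r IHr] sI; first by exists [::].
  have [|t [tI tr]] := IHr; first by move=> c cr; apply: sI; rewrite /= inE cr orbT.
  have [p [Ip sp pd]] : lead_ideal I d b by apply: sI; rewrite /= mem_head.
  exists (p :: t); split=> [q|c].
    by rewrite /= inE => /predU1P[->|/tI].
  rewrite inE => /predU1P[->|/tr[q qt qc]]; first by exists p; rewrite ?mem_head.
  by exists q => //; rewrite inE qt orbT.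
exists t; split=> // J idJ tJ p Ip sp.
have idJI : ideal (J `&` I).
  split; first by split; apply: ideal0.
    by move=> x y [Jx Ix] [Jy Iy]; split; apply: idealD.
  by move=> a x [Jx Ix]; split; apply: idealMl.
have : lead_ideal (J `&` I) d p`_d; last by move=> [q [[Jq Iq] sq qd]]; exists q.
apply: (sJ _ (lead_ideal_ideal d idJI)); last by exists p.
move=> b /ts [q qt [sq qb]]; exists q; split=> //; split; [exact: tJ|exact: tI].
Qed.

(** Leading coefficients of all degrees form an ideal whose finitely many generators all occur in
    one degree D. Lifts in degrees up to D suffice: any p in I loses its leading term by subtracting
    an element of J of the same degree, obtained above D by multiplying one of degree D by a power
    of X. *)
Theorem hilbert_basis : noetherian {poly A}.
Proof.
move=> I idI; pose lcs : set A := [set b | exists d, lead_ideal I d b].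
have idlcs : ideal lcs.
  have idl d := lead_ideal_ideal d idI; split.
  - by exists 0%N; apply: ideal0.
  - move=> x y [d Ix] [e Iy]; exists (maxn d e).
    apply: (idealD (idl _)).
      exact: (lead_idealS idI (leq_maxl d e) Ix).
    exact: (lead_idealS idI (leq_maxr d e) Iy).
  - by move=> a x [d Ix]; exists d; apply: (idealMl (idl d)).
have [s [sl slJ]] := nA idlcs.
have [D sD] : exists D, [set` s] `<=` lead_ideal I D.
  elim: (s) sl => [|b r IHr] sl; first by exists 0%N.
  have [|D rD] := IHr; first by move=> c cr; apply: sl; rewrite /= inE cr orbT.
  have [d bd] : lcs b by apply: sl; rewrite /= mem_head.
  exists (maxn d D) => c; rewrite /= inE => /predU1P[->|/rD].
    exact: (lead_idealS idI (leq_maxl d D) bd).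
  exact: (lead_idealS idI (leq_maxr d D)).
have lcsD := slJ _ (lead_ideal_ideal D idI) sD.
have [t tP] := choice (fun d => lead_ideal_lift d idI).
exists (flatten [seq t d | d <- iota 0 D.+1]); split.
  by move=> p /flatten_mapP[d _ pt]; apply: (tP d).1.
move=> J idJ tJ p; have [n] := ubnP (size p); elim: n p => // n IHn p.
rewrite ltnS => sp Ip; case: n sp IHn => [|d] sp IHn.
  by move: sp; rewrite leqn0 size_poly_eq0 => /eqP ->; apply: ideal0.
have tdJ e : (e <= D)%N -> [set` t e] `<=` J.
  by move=> eD q qt; apply: tJ; apply/flatten_mapP; exists e; rewrite // mem_iota.
have [q [Jq Iq sq qd]] :
    exists q, [/\ J q, I q, (size q <= d.+1)%N & q`_d = p`_d].
  have [dD|/ltnW Dd] := leqP d D; first exact: ((tP d).2 J idJ (tdJ d dD)).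
  have [r [Ir sr rD]] : lead_ideal I D p`_d by apply: lcsD; exists d, p.
  have [q [Jq Iq sq qD]] := (tP D).2 J idJ (tdJ D (leqnn D)) r Ir sr.
  have idJI : ideal (J `&` I).
    split; first by split; apply: ideal0.
      by move=> x y [Jx Ix] [Jy Iy]; split; apply: idealD.
    by move=> a x [Jx Ix]; split; apply: idealMl.
  have : lead_ideal (J `&` I) D p`_d by exists q; rewrite qD.
  by move=> /(lead_idealS idJI Dd)[u [[Ju Iu] su ud]]; exists u.
rewrite -(subrK q p); apply: (idealD idJ) => //; apply: IHn; last exact: idealB.
rewrite ltnS; apply/leq_sizeP => i; rewrite leq_eqVlt => /predU1P[<-|di].
  by rewrite coefB qd subrr.
by rewrite coefB !nth_default ?subrr // (leq_trans _ di).
Qed.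

End HilbertBasis.

(** Evaluation at the last variable maps the univariate polynomials over n variables onto the
    polynomials in n + 1 variables. *)
Lemma noetherian_mpoly (F : fieldType) n : noetherian {mpoly F[n]}.
Proof.
elim: n => [|n IHn].
  apply: (@noetherian_surj _ _ (@mpolyC 0 F)) (@noetherian_field F) => p.
  exists p@_0%MM; apply/mpolyP => m; have -> : m = 0%MM by apply/mnmP => -[].
  by rewrite mcoeffC eqxx mulr1.
pose f : {rmorphism {poly {mpoly F[n]}} -> {mpoly F[n.+1]}} :=
  horner_eval 'X_ord_max \o map_poly (@mwiden n F).
apply: (noetherian_surj (f := f)) (hilbert_basis IHn) => p.
elim/mpolyind: p => [|c m p _ _ [q <-]]; first by exists 0; rewrite rmorph0.
suff [u um] : exists u, f u = 'X_[m].
  exists ((c%:MP)%:P * u + q); rewrite rmorphD rmorphM um /=.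
  by rewrite /horner_eval map_polyC hornerC /= mwidenC mul_mpolyC.
rewrite mpolyXE_id; apply: (big_ind (fun y => exists u, f u = y)).
- by exists 1; rewrite rmorph1.
- by move=> _ _ [u <-] [v <-]; exists (u * v); rewrite rmorphM.
move=> i _; suff [u <-] : exists u, f u = 'X_i.
  by exists (u ^+ m i); rewrite rmorphXn.
case: (unliftP ord_max i) => [k ->|->]; last first.
  by exists 'X; rewrite /f /= /horner_eval map_polyX hornerX.
exists ('X_k)%:P; rewrite /f /= /horner_eval map_polyC hornerC /= mwidenX mnmwiden1.
by congr 'X_[U_(_)]; apply: val_inj; rewrite /= /bump leqNgt ltn_ord.
Qed.

(** The polynomials vanishing at z are generated by finitely many [Fs]. Those vanishing at x also
    form an ideal, so a common zero x of [Fs] satisfies all the equations of z. *)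
Theorem artin_lang (R : rcfType) (K : fieldType) (j : {rmorphism R -> K})
    (n : nat) (z : 'I_n -> K) (G : {mpoly R[n]}) :
    formally_real K -> mmap j z G != 0 ->
  exists x : 'I_n -> R, mmap idfun x G != 0 /\
    forall F, mmap j z F = 0 -> mmap idfun x F = 0.
Proof.
move=> realK Gz.
have ker_ideal (L : fieldType) (f : {rmorphism R -> L}) (y : 'I_n -> L) :
    ideal [set F : {mpoly R[n]} | mmap f y F = 0].
  split=> [|F H /= F0 H0|F H /= H0]; first by rewrite /= rmorph0.
    by rewrite rmorphD /= F0 H0 addr0.
  by rewrite rmorphM /= H0 mulr0.
have [Fs [FsZ Fs_gen]] := noetherian_mpoly (ker_ideal _ j z).
have [|x [Gx Fx]] := artin_lang_finite realK Gz (Fs := Fs).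
  by apply/allP => F /FsZ /= ->.
exists x; split=> // F Fz.
apply: (Fs_gen _ (ker_ideal _ (idfun : {rmorphism R -> R}) x)) => // H HFs.
exact/eqP/(allP Fx).
Qed.

(** * Residue fields *)

Lemma fraction_numden (D : idomainType) (r : {ratio D}) :
  (\pi_{fraction D} r)%qT = tofrac \n_r / tofrac \d_r.
Proof.
have d0 : tofrac \d_r != 0 by rewrite tofrac_eq0 denom_ratioP.
apply: (mulIf d0); rewrite divfK //; unlock tofrac; rewrite -[LHS]FracField.pi_mul.
apply/eqmodP; rewrite /= FracField.equivfE /FracField.mulf.
by rewrite !numden_Ratio ?mulf_neq0 ?denom_ratioP ?oner_neq0 // !mulr1 mulrC.
Qed.

Section IntegralDomainFractions.
Context {B : comNzRingType} (Bint : forall x y : B, x * y = 0 -> x = 0 \/ y = 0).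

(** [idomainType] includes a unit predicate and an inverse; classical choice supplies both for an
    arbitrary domain. *)
Definition cl_unit : pred B := fun x => `[< exists y, y * x = 1 >].
Definition cl_inv (x : B) : B :=
  if pselect (exists y, y * x = 1) is left h then projT1 (cid h) else x.

Fact cl_mulVr : {in cl_unit, left_inverse 1 cl_inv *%R}.
Proof.
move=> x /asboolP ux; rewrite /cl_inv; case: pselect => // h.
by case: cid.
Qed.

Fact cl_unitP x y : y * x = 1 -> cl_unit x.
Proof. by move=> yx; apply/asboolP; exists y. Qed.

Fact cl_invr_out : {in [predC cl_unit], cl_inv =1 id}.
Proof.
by move=> x /asboolP ux; rewrite /cl_inv; case: pselect.
Qed.

Fact cl_integral (x y : B) : x * y = 0 -> (x == 0) || (y == 0).
Proof. by case/Bint => ->; rewrite eqxx ?orbT. Qed.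

Lemma fraction_field : exists (K : fieldType) (f : {rmorphism B -> K}),
  (forall x, f x = 0 -> x = 0) /\
  forall y, exists a b, f b != 0 /\ y = f a / f b.
Proof.
pose U : comUnitRingType := HB.pack B
  (GRing.ComNzRing_hasMulInverse.Build B cl_mulVr cl_unitP cl_invr_out).
pose D : idomainType := HB.pack U
  (GRing.ComUnitRing_isIntegral.Build U cl_integral).
pose f : {rmorphism D -> {fraction D}} := @tofrac D.
exists {fraction D}, f; split=> [x /eqP|y]; first by rewrite tofrac_eq0 => /eqP.
elim/quotP: y => r _.
exists (\n_r), (\d_r); split; first by rewrite tofrac_eq0 denom_ratioP.
exact: fraction_numden.
Qed.
End IntegralDomainFractions.

Section ResidueField.
Context {A : comPzRingType} (p : set A).
Context (p0 : p 0) (pD : forall x y, p x -> p y -> p (x + y)).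
Context (pM : forall a x, p x -> p (a * x)) (p1 : ~ p 1).
Context (p_prime : forall x y, p (x * y) -> p x \/ p y).

Lemma residue_field : exists (K : fieldType) (f : {rmorphism A -> K}),
  (forall x, f x = 0 <-> p x) /\
  forall y, exists a b, f b != 0 /\ y = f a / f b.
Proof.
have A1 : 1 != 0 :> A by apply/eqP => e; apply: p1; rewrite e.
pose B : comNzRingType := HB.pack A (GRing.PzSemiRing_isNonZero.Build A A1).
pose S : B -> bool := fun x => `[< p x >].
have S_ideal : idealr_closed S.
  split; first exact/asboolP; first exact/asboolP.
  by move=> a x y /asboolP px /asboolP py; apply/asboolP/pD => //; apply: pM.
have S_prime : prime_idealr_closed S.
  by move=> x y /asboolP /p_prime xy; apply/orP; case: xy => ?; [left|right];
    apply/asboolP.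
pose I : prime_idealr B := HB.pack S (isIdealr.Build B S S_ideal)
  (isPrimeIdealrClosed.Build B S S_prime).
have Qint (x y : {ideal_quot I}) : x * y = 0 -> x = 0 \/ y = 0.
  by move=> /Quotient.rquot_IdomainAxiom /orP[] /eqP; [left|right].
have [K [f [f0 fK]]] := fraction_field Qint.
pose g (x : A) : K := f (\pi_{ideal_quot I} (x : B))%qT.
have gB : zmod_morphism g by move=> x y; rewrite /g !rmorphB.
have gM : monoid_morphism g.
  by split=> [|x y]; rewrite /g ?rmorph1 ?rmorphM.
pose h : {rmorphism A -> K} := HB.pack g
  (GRing.isZmodMorphism.Build A K g gB) (GRing.isMonoidMorphism.Build A K g gM).
have pi0 x : (\pi_{ideal_quot I} x = 0)%qT <-> p x.
  have e : (x \in I) = (\pi_{ideal_quot I} x == 0)%qT.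
    by rewrite -[x in LHS]subr0 Quotient.idealrBE rmorph0.
  split=> [/eqP|/asboolP px]; first by rewrite -e => /asboolP.
  by apply/eqP; rewrite -e.
exists K, h; split=> [x|y].
  split=> [/f0/pi0//|px]; rewrite /= /g.
  by have/pi0 -> := px; rewrite rmorph0.
have [a [b [fb ->]]] := fK y.
exists (repr a), (repr b); rewrite /= /g !reprK.
by split.
Qed.
End ResidueField.

(** * Real submodules *)

(** A family in W of maximal rank works, as adjoining a further w cannot raise the rank. W is an
    arbitrary set because the image of a submodule of A^n in K^n is in general no K-subspace. *)
Lemma spanning_family (K : fieldType) n (W : set 'rV[K]_n) :
  exists r (G : 'M[K]_(r, n)),
    (forall i, W (row i G)) /\ forall w, W w -> (w <= G)%MS.
Proof.
pose P d := `[< exists r (G : 'M[K]_(r, n)),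
  (forall i, W (row i G)) /\ \rank G = d >].
have exP : exists d, P d.
  by exists 0%N; apply/asboolP; exists 0%N, 0; split; [case|rewrite mxrank0].
have ubP d : P d -> (d <= n)%N.
  by move=> /asboolP[r [G [_ <-]]]; apply: rank_leq_col.
case: (ex_maxnP exP ubP) => d /asboolP[r [G [GW rG]]] dmax.
exists r, G; split=> // w Ww.
pose H := col_mx G w.
have GH : (G <= H)%MS by rewrite -addsmxE addsmxSl.
have wH : (w <= H)%MS by rewrite -addsmxE addsmxSr.
apply: (submx_trans wH).
rewrite -(geq_leqif (mxrank_leqif_sup GH)) rG; apply: dmax; apply/asboolP.
exists (r + 1)%N, H; split=> // i; rewrite /H.
case: (split_ordP i) => k ->; first by rewrite rowKu.
by rewrite rowKd ord1 row_id.
Qed.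

Section RealSubmodules.
Context {A : comPzRingType} {n : nat}.
Implicit Types (N P : set 'rV[A]_n) (u v f : 'rV[A]_n).

Definition tens_sum N : set 'M[A]_n :=
  [set X + Y | X in tens_sub setT N & Y in tens_sub N setT].

Lemma submod_props N : is_submodule N ->
  [/\ N 0, forall u v, N u -> N v -> N (u + v) & forall a u, N u -> N (a *: u)].
Proof.
move=> [N0 Nl]; have {}N0 : N 0 by move: N0; rewrite inE.
have {}Nl a u v : N u -> N v -> N (a *: u + v).
  by move=> Nu Nv; have := Nl a u v; rewrite !inE; apply.
split=> // [u v Nu Nv|a u Nu]; first by rewrite -[u]scale1r; apply: Nl.
by rewrite -[_ *: _]addr0; apply: Nl.
Qed.

Lemma submodI N : N 0 -> (forall a u v, N u -> N v -> N (a *: u + v)) ->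
  is_submodule N.
Proof.
by move=> N0 Nl; split=> [|a u v]; rewrite !inE; [exact: N0|exact: Nl].
Qed.

Lemma submod_sum N (I : Type) (r : seq I) (F : I -> 'rV[A]_n) :
  is_submodule N -> (forall i, N (F i)) -> N (\sum_(i <- r) F i).
Proof.
by move=> /submod_props[N0 ND _] NF; apply: (big_ind N).
Qed.

Lemma tens_sub_cat P N X Y :
  tens_sub P N X -> tens_sub P N Y -> tens_sub P N (X + Y).
Proof.
move=> [s sP ->] [t tP ->]; exists (s ++ t); last by rewrite big_cat.
by move=> x; rewrite /= mem_cat => /orP[/sP|/tP].
Qed.

Lemma tens_sub0 P N : tens_sub P N 0.
Proof. by exists [::]; rewrite ?big_nil. Qed.

Lemma tens_sub1 P N u v : P u -> N v -> tens_sub P N (tens u v).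
Proof.
move=> Pu Nv; exists [:: (u, v)]; last by rewrite big_seq1.
by move=> x; rewrite /= inE => /eqP ->.
Qed.

Lemma tens_sumD N X Y : tens_sum N X -> tens_sum N Y -> tens_sum N (X + Y).
Proof.
move=> [X1 X1N [X2 X2N <-]] [Y1 Y1N [Y2 Y2N <-]]; rewrite addrACA.
exists (X1 + Y1); first exact: tens_sub_cat.
by exists (X2 + Y2) => //; apply: tens_sub_cat.
Qed.

Lemma tens_sum_l N u v : N u -> tens_sum N (tens u v).
Proof.
move=> Nu; exists 0; first exact: tens_sub0.
by exists (tens u v); [apply: tens_sub1|rewrite add0r].
Qed.

Lemma tens_sum_r N u v : N v -> tens_sum N (tens u v).
Proof.
move=> Nu; exists (tens u v); first exact: tens_sub1.
by exists 0; [apply: tens_sub0|rewrite addr0].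
Qed.

Lemma tensZ a b u v : tens (a *: u) (b *: v) = (a * b) *: tens u v.
Proof. by apply/matrixP => i k; rewrite !(tensE, mxE) mulrACA. Qed.

(** A single list of pure tensors, each with one factor in N, is the form that passes to unions of
    chains and to multiples by a scalar. *)
Lemma tens_sum_seq N X : tens_sum N X -> exists s : seq ('rV[A]_n * 'rV[A]_n),
  (forall x, x \in s -> N x.1 \/ N x.2) /\ X = \sum_(x <- s) tens x.1 x.2.
Proof.
move=> [_ [s sN ->] [_ [t tN ->] <-]]; exists (s ++ t); rewrite big_cat.
split=> // x; rewrite mem_cat => /orP[/sN[_ ?]|/tN[? _]]; [by right|by left].
Qed.

Lemma tens_sum_of_seq N (s : seq ('rV[A]_n * 'rV[A]_n)) :
  (forall x, x \in s -> N x.1 \/ N x.2) -> tens_sum N (\sum_(x <- s) tens x.1 x.2).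
Proof.
elim: s => [|x s IHs] sN.
  rewrite big_nil; exists 0; first exact: tens_sub0.
  by exists 0; [apply: tens_sub0|rewrite addr0].
rewrite big_cons; apply: tens_sumD; last first.
  by apply: IHs => y ys; apply: sN; rewrite inE ys orbT.
by case: (sN x (mem_head _ _)) => ?; [apply: tens_sum_l|apply: tens_sum_r].
Qed.

(** A membership in [tens_sum] involves finitely many elements of the union, which all lie in one
    member of the chain. *)
Lemma real_chain (F : set (set 'rV[A]_n)) : F !=set0 ->
    F `<=` @is_real A n -> total_on F subset ->
  is_real (\bigcup_(P in F) P).
Proof.
move=> [P0 FP0] Freal Ftot k m /tens_sum_seq[s [sF es]] i.
have [P FP sP] : exists2 P, F P & forall x, x \in s -> P x.1 \/ P x.2.
  elim: s sF {es} => [|x s IHs] sF; first by exists P0.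
  have [|P FP sP] := IHs; first by move=> y ys; apply: sF; rewrite inE ys orbT.
  have [Q FQ xQ] : exists2 Q, F Q & Q x.1 \/ Q x.2.
    by case: (sF x (mem_head _ _)) => -[Q FQ Qx]; exists Q; by [|left|right].
  case: (Ftot P Q FP FQ) => PQ; [exists Q|exists P] => // y;
    rewrite inE => /predU1P[->|/sP] //.
    by case=> /PQ; [left|right].
  by case: xQ => /PQ; [left|right].
exists P => //; apply: (Freal P FP k m _ i).
by rewrite es; apply: tens_sum_of_seq.
Qed.

(** Multiplying the relation for the m_i by a^2 and moving one a into each factor gives a relation
    for the a m_i over N. *)
Lemma real_colon N a : is_real N -> is_real [set u | N (a *: u)].
Proof.
move=> Nreal k m /tens_sum_seq[s [sN es]] i.
apply: (Nreal k (fun i => a *: m i) _ i).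
have -> : \sum_i tens (a *: m i) (a *: m i) =
          \sum_(x <- [seq (a *: x.1, a *: x.2) | x <- s]) tens x.1 x.2.
  rewrite big_map; transitivity ((a * a) *: \sum_i tens (m i) (m i)).
    by rewrite scaler_sumr; apply: eq_bigr => l _; rewrite tensZ.
  by rewrite es scaler_sumr; apply: eq_bigr => x _; rewrite -tensZ.
by apply: tens_sum_of_seq => _ /mapP[x /sN xN ->].
Qed.

Lemma submod_colon N a : is_submodule N -> is_submodule [set u | N (a *: u)].
Proof.
move=> /submod_props[N0 ND NZ]; apply: submodI => [|b u v Nu Nv] /=.
  by rewrite scaler0.
by rewrite scalerDr scalerA mulrC -scalerA; apply: ND => //; apply: NZ.
Qed.

(** * Real submodules maximal among those that avoid f *)

Section MaximalReal.
Context {N : set 'rV[A]_n} {f : 'rV[A]_n}.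
Context (subN : is_submodule N) (realN : is_real N) (Nf : ~ N f).
Context (maxN : forall P, is_submodule P -> is_real P -> ~ P f ->
                  N `<=` P -> P `<=` N).

Definition colon : set A := [set a | N (a *: f)].

Lemma colon0 : colon 0.
Proof. by have [N0 _ _] := submod_props subN; rewrite /colon /= scale0r. Qed.

Lemma colonD a b : colon a -> colon b -> colon (a + b).
Proof.
by have [_ ND _] := submod_props subN; rewrite /colon /= scalerDl; apply: ND.
Qed.

Lemma colonM a b : colon b -> colon (a * b).
Proof.
by have [_ _ NZ] := submod_props subN; rewrite /colon /= -scalerA; apply: NZ.
Qed.

Lemma colon1 : ~ colon 1.
Proof. by rewrite /colon /= scale1r. Qed.

(** If a f is not in N, then (N : a) is a real submodule above N without f, so it is contained in N
    by maximality; it contains b f. *)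
Lemma colon_prime a b : colon (a * b) -> colon a \/ colon b.
Proof.
move=> ab; have [?|nb] := pselect (colon b); [by right|left].
apply: contrapT => na; apply: nb.
have [_ _ NZ] := submod_props subN.
apply: (maxN (submod_colon a subN) (real_colon (a := a) realN) na).
  by move=> u Nu; apply: NZ.
by rewrite /= scalerA.
Qed.

(** The sum of the (a f) (x) (a f) is ((sum of the a^2) f) (x) f, whose first factor is in N. *)
Lemma colon_real (s : seq A) : colon (\sum_(a <- s) a ^+ 2) ->
  {in s, forall a, colon a}.
Proof.
move=> cs a /(nthP 0)[k ks <-].
apply: (realN (m := fun i : 'I_(size s) => s`_i *: f) _ (Ordinal ks)).
have -> : \sum_i tens (s`_(i : 'I_(size s)) *: f) (s`_i *: f) =
          tens ((\sum_(a <- s) a ^+ 2) *: f) f.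
  rewrite -[X in tens _ X]scale1r tensZ mulr1 (big_nth 0) big_mkord.
  by rewrite scaler_suml; apply: eq_bigr => i _; rewrite tensZ expr2.
exact: tens_sum_l.
Qed.

(* The class of f is still nonzero after localizing M / N at [colon] and
   reducing modulo it. *)
Lemma colon_fiber s h : N h -> (forall i, colon ((s *: f - h) 0 i)) -> colon s.
Proof.
move=> Nh; set g := s *: f - h => gc.
apply: (realN (m := fun i : 'I_1 => s *: f) _ ord0); rewrite big_ord1.
(* Only the second factor is expanded, as s f = h + g with g in coordinates. Then h is in N, and
   each (s g_i) f is in N because g_i lies in [colon]. *)
have -> : tens (s *: f) (s *: f) =
    tens (s *: f) h + \sum_i tens ((s * g 0 i) *: f) (delta_mx 0 i).
  have [_ tr] := @tens_bilinear A n.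
  rewrite {2}(_ : s *: f = 1 *: h + g); last by rewrite scale1r /g addrC subrK.
  rewrite tr scale1r; congr (_ + _).
  apply/matrixP => i k; rewrite summxE !(tensE, mxE) (bigD1 k) //= big1 => [|l lk].
    by rewrite !(tensE, mxE) !eqxx mulr1 addr0 mulrAC.
  by rewrite !(tensE, mxE) eq_sym (negbTE lk) andbF mulr0.
apply: tens_sumD; first exact: tens_sum_r.
apply: (big_ind (tens_sum N)); first 1 last.
- exact: tens_sumD.
- by move=> i _; apply: tens_sum_l; apply: colonM.
have [N0 _ _] := submod_props subN.
by have := tens_sum_l 0 N0; rewrite /tens mulmx0.
Qed.

End MaximalReal.
End RealSubmodules.

Lemma common_denominator (A : comPzRingType) (K : fieldType)
    (t : {rmorphism A -> K}) (tK : forall y, exists a b, t b != 0 /\ y = t a / t b)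
    (s : seq K) :
  exists b, t b != 0 /\ exists g : K -> A, {in s, forall y, t (g y) = y * t b}.
Proof.
suff [b [tb sb]] : exists b, t b != 0 /\
    {in s, forall y, exists a, t a = y * t b}.
  exists b; split=> //; have /choice[g gP] : forall y, exists a, y \in s -> t a = y * t b.
    move=> y; have [/sb[a ta]|ns] := boolP (y \in s); first by exists a.
    by exists 0.
  by exists g.
elim: s => [|y s [b [tb sb]]]; first by exists 1; rewrite rmorph1 oner_neq0.
have [a [d [td ->]]] := tK y; exists (b * d); rewrite rmorphM mulf_neq0 //.
split=> // x; rewrite inE => /predU1P[->|/sb[c tc]].
  by exists (a * b); rewrite rmorphM [t b * _]mulrC mulrA divfK.
by exists (c * d); rewrite rmorphM tc mulrA.
Qed.

(** Clearing denominators in -1 = sum of y^2 gives a sum of squares in the kernel of t that includes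
    b^2, where b is the common denominator; this contradicts t b != 0. *)
Lemma formally_real_fractions (A : comPzRingType) (K : fieldType)
    (t : {rmorphism A -> K}) :
    (forall y, exists a b, t b != 0 /\ y = t a / t b) ->
    (forall s : seq A, t (\sum_(a <- s) a ^+ 2) = 0 ->
      {in s, forall a, t a = 0}) ->
  formally_real K.
Proof.
move=> tK treal s es; have [b [tb [g gs]]] := common_denominator tK s.
suff /treal /(_ b) : t (\sum_(a <- b :: map g s) a ^+ 2) = 0.
  by rewrite mem_head => /(_ isT) tb0; rewrite tb0 eqxx in tb.
rewrite big_cons big_map rmorphD rmorph_sum rmorphXn /=.
have -> : \sum_(y <- s) t (g y ^+ 2) = \sum_(y <- s) y ^+ 2 * t b ^+ 2.
  rewrite big_seq [RHS]big_seq; apply: eq_bigr => y ys.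
  by rewrite rmorphXn /= gs // exprMn.
by rewrite -mulr_suml es mulN1r subrr.
Qed.

(** * Separating f from N by a real zero *)

Section Separation.
Context {R : realType} {A : comPzRingType} (iota : {rmorphism R -> A}).
Context (A_fin_gen : fin_gen_alg iota) {n : nat}.
Context {N : set 'rV[A]_n} {f : 'rV[A]_n}.
Context (subN : is_submodule N) (realN : is_real N) (Nf : ~ N f).
Context (maxN : forall P, is_submodule P -> is_real P -> ~ P f ->
                  N `<=` P -> P `<=` N).

Lemma generic_point : exists (K : fieldType) (t : {rmorphism A -> K})
    (u : 'I_n -> K), [/\ formally_real K,
    forall g, N g -> \sum_i t (g 0 i) * u i = 0
    & \sum_i t (f 0 i) * u i != 0].
Proof.
have [K [t [t0 tK]]] := residue_field (colon0 subN) (@colonD _ _ _ f subN)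
  (@colonM _ _ _ f subN) (colon1 Nf) (colon_prime subN realN maxN).
have treal (s : seq A) : t (\sum_(a <- s) a ^+ 2) = 0 -> {in s, forall a, t a = 0}.
  by move=> /t0 cs a as_; apply/t0; apply: (colon_real realN cs).
have realK := formally_real_fractions tK treal.
have [r [G [GN NG]]] := spanning_family [set map_mx t g | g in N].
(* If f were in the K-span of N, a common denominator b of the coefficients would give h in N with
   all coordinates of b f - h in [colon]. Then b would be in [colon] by [colon_fiber], although t b
   != 0. *)
have nfG : ~~ (map_mx t f <= G)%MS.
  apply/negP => /submxP[D fD].
  have [b [tb [d dD]]] := common_denominator tK [seq D 0 i | i : 'I_r].
  have /choice[g gP] : forall i : 'I_r, exists g, N g /\ map_mx t g = row i G.
    by move=> i; have [g Ng e] := GN i; exists g.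
  have [N0 ND NZ] := submod_props subN.
  pose h := \sum_i d (D 0 i) *: g i.
  have Nh : N h.
    by apply: submod_sum => // i; apply: NZ; have [] := gP i.
  have /(colon_fiber subN realN Nh) /t0 tb0 :
      forall i, @colon A n N f ((b *: f - h) 0 i).
    move=> i; apply/t0; rewrite !mxE summxE rmorphB rmorphM rmorph_sum.
    have := congr1 (fun v : 'rV_n => v 0 i) fD; rewrite mxE => ->.
    rewrite mxE mulr_sumr; apply/eqP; rewrite subr_eq0; apply/eqP.
    apply: eq_bigr => k _; rewrite mxE rmorphM dD ?map_f ?mem_enum //.
    have /(congr1 (fun v : 'rV_n => v 0 i)) := (gP k).2; rewrite !mxE => ->.
    by rewrite mulrCA mulrA.
  by rewrite tb0 eqxx in tb.
(* The columns of the cokernel matrix are orthogonal to N; one that is not orthogonal to f is the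
   required u. *)
have [k fk] : exists k, (map_mx t f *m cokermx G) 0 k != 0.
  apply: contrapT => nk; move: nfG; rewrite submxE => /eqP; apply.
  apply/rowP => k; rewrite [RHS]mxE; apply/eqP; apply: contrapT => /negP h.
  by apply: nk; exists k.
have pairE (g : 'rV[A]_n) :
    \sum_i t (g 0 i) * cokermx G i k = (map_mx t g *m cokermx G) 0 k.
  by rewrite [RHS]mxE; apply: eq_bigr => i _; rewrite [map_mx _ _ _ _]mxE.
exists K, t, (fun i => cokermx G i k); split=> // [g Ng|]; rewrite pairE //.
have /eqP -> : map_mx t g *m cokermx G == 0.
  by rewrite -submxE; apply: NG; exists g.
by rewrite mxE.
Qed.

Lemma separation : exists p : {rmorphism A -> R} * 'rV[R]_n,
  real_zeros iota N p /\ pairing p.1 f p.2 != 0.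
Proof.
have [K [t [u [realK uN uf]]]] := generic_point.
have [s s_gen] := A_fin_gen.
pose m := size s; pose j : {rmorphism R -> K} := t \o iota.
(* The first m coordinates determine the morphism on the generators of A, the last n the vector
   u. *)
pose z (i : 'I_(m + n)) : K := match split i with
  | inl k => t s`_k | inr k => u k end.
have zr k : z (rshift m k) = u k by rewrite /z; case: split_ordP => l /eqP;
  rewrite ?eq_rlshift ?eq_rshift // => /eqP ->.
have zl k : z (lshift n k) = t s`_k by rewrite /z; case: split_ordP => l /eqP;
  rewrite ?eq_lrshift ?eq_lshift // => /eqP ->.
have mmapX (L : fieldType) (h : {rmorphism R -> L}) (y : 'I_(m + n) -> L) i :
  mmap h y 'X_i = y i by rewrite mmapX mmap1U.
have /choice[F FP] : forall a, exists F : {mpoly R[m + n]}, mmap j z F = t a.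
  pose S := [set a | exists F : {mpoly R[m + n]}, mmap j z F = t a].
  move=> a; suff : S a by []; suff -> : S = setT by [].
  apply: s_gen.
  - split=> [|x y|x y]; rewrite !inE /S /=.
    + by exists 1; rewrite !rmorph1.
    + by move=> [P Px] [Q Qy]; exists (P - Q); rewrite !rmorphB /= Px Qy.
    + by move=> [P Px] [Q Qy]; exists (P * Q); rewrite !rmorphM /= Px Qy.
  - by move=> _ [c _ <-]; exists c%:MP; rewrite mmapC.
  - move=> x /= xs; exists 'X_(lshift n (Ordinal (etrans (index_mem x s) xs))).
    by rewrite mmapX zl /= nth_index.
pose H (g : 'rV[A]_n) := \sum_i F (g 0 i) * 'X_(rshift m i).
have HE g : mmap j z (H g) = \sum_i t (g 0 i) * u i.
  rewrite rmorph_sum; apply: eq_bigr => i _.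
  by rewrite rmorphM /= FP mmapX zr.
have [|x [xf xker]] := @artin_lang R K j _ z (H f) realK; first by rewrite HE.
(* [F a] is an arbitrary choice of a polynomial with value [t a]. Since x satisfies every relation
   of z, values at x are independent of this choice, and this makes [phi] a morphism. *)
have xeq P Q : mmap j z P = mmap j z Q -> mmap idfun x P = mmap idfun x Q.
  move=> PQ; apply/eqP; rewrite -subr_eq0 -rmorphB; apply/eqP/xker.
  by rewrite rmorphB /= PQ subrr.
pose phi a : R := mmap idfun x (F a).
have phiB : zmod_morphism phi.
  by move=> a b; rewrite /phi -rmorphB; apply: xeq; rewrite rmorphB /= !FP rmorphB.
have phiM : monoid_morphism phi.
  split=> [|a b]; rewrite /phi.
    by rewrite -(rmorph1 (mmap idfun x)); apply: xeq; rewrite FP !rmorph1.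
  by rewrite -rmorphM; apply: xeq; rewrite rmorphM /= !FP rmorphM.
pose Phi : {rmorphism A -> R} := HB.pack phi
  (GRing.isZmodMorphism.Build A R phi phiB)
  (GRing.isMonoidMorphism.Build A R phi phiM).
pose w : 'rV[R]_n := \row_i x (rshift m i).
have pairE g : pairing Phi g w = mmap idfun x (H g).
  rewrite rmorph_sum; apply: eq_bigr => i _.
  by rewrite rmorphM /= mmapX !mxE.
exists (Phi, w); split; last by rewrite /= pairE.
split=> [c|g Ng] /=.
  have -> : c = mmap idfun x (c%:MP : {mpoly R[m + n]}) by rewrite mmapC.
  by rewrite /phi; apply: xeq; rewrite FP !mmapC.
by rewrite pairE; apply: xker; rewrite HE uN.
Qed.

End Separation.

(** * The saturation is a real submodule *)

Section Pairing.
Context {R : realType} {A : comPzRingType} {n : nat}.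
Implicit Types (phi : {rmorphism A -> R}) (g h : 'rV[A]_n) (u : 'rV[R]_n).

Lemma pairingD phi a g h u :
  pairing phi (a *: g + h) u = phi a * pairing phi g u + pairing phi h u.
Proof.
rewrite /pairing mulr_sumr -big_split; apply: eq_bigr => i _ /=.
by rewrite !mxE rmorphD rmorphM mulrDl mulrA.
Qed.

(** This is the functional on the tensor square that pairs both factors with u. *)
Definition pairing2 phi u (X : 'M[A]_n) : R :=
  \sum_i \sum_k phi (X i k) * (u 0 i * u 0 k).

Lemma pairing2_sum phi u (I : Type) (r : seq I) (F : I -> 'M[A]_n) :
  pairing2 phi u (\sum_(i <- r) F i) = \sum_(i <- r) pairing2 phi u (F i).
Proof.
rewrite /pairing2 [RHS]exchange_big; apply: eq_bigr => i _ /=.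
rewrite [RHS]exchange_big; apply: eq_bigr => k _ /=.
by rewrite summxE rmorph_sum mulr_suml.
Qed.

Lemma pairing2_tens phi u g h :
  pairing2 phi u (tens g h) = pairing phi g u * pairing phi h u.
Proof.
rewrite /pairing2 /pairing mulr_suml; apply: eq_bigr => i _.
rewrite mulr_sumr; apply: eq_bigr => k _.
by rewrite tensE !mxE rmorphM mulrACA.
Qed.

End Pairing.

(** At a zero of N, [pairing2] kills every tensor with a factor in the saturation and sends the sum
    of the m_i (x) m_i to a sum of squares of reals, each of which must vanish. *)
Lemma real_submodule_saturation (R : realType) (A : comPzRingType)
    (iota : {rmorphism R -> A}) (n : nat) (N : set 'rV[A]_n) :
  real_submodule_over N (real_saturation iota N).
Proof.
split; last by move=> g Ng [phi u] [_ zN]; apply: zN.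
- apply: submodI => [[phi u] _|a g h zg zh p zp] /=.
    by rewrite /pairing big1 // => i _; rewrite !mxE rmorph0 mul0r.
  by rewrite pairingD zg // zh // mulr0 addr0.
- move=> k m /tens_sum_seq[s [sN es]] i [phi u] zp /=.
  have : \sum_i pairing phi (m i) u ^+ 2 = 0.
    rewrite (eq_bigr (fun i => pairing2 phi u (tens (m i) (m i)))); last first.
      by move=> l _; rewrite pairing2_tens expr2.
    rewrite -pairing2_sum es pairing2_sum big_seq big1 // => x /sN.
    by rewrite pairing2_tens; case=> /(_ _ zp) /= ->; rewrite ?mul0r ?mulr0.
  move=> /eqP; rewrite psumr_eq0 => [|l _]; last exact: sqr_ge0.
  by move=> /allP /(_ i (mem_index_enum i)); rewrite /= sqrf_eq0 => /eqP.
Qed.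

Theorem theorem2 (R : realType) (A : comPzRingType)
    (iota : {rmorphism R -> A}) (A_fin_gen : fin_gen_alg iota)
    (n : nat) (n_gt0 : (0 < n)%N)
    (N : set 'rV[A]_n) (N_submodule : is_submodule N) :
  real_saturation iota N = real_radical N.
Proof.
apply/seteqP; split=> [f zf P [subP realP NP]|f]; last first.
  by apply; apply: real_submodule_saturation.
apply: contrapT => nPf.
(* The real submodule P over N that misses f is enlarged to a maximal one, M; zeros of M are still
   zeros of N. *)
have [|F F0 FP Ftot|M [[subM realM nMf] PM Mmax]] :=
    @Zorn_above _ [set M | [/\ is_submodule M, is_real M & ~ M f]] P.
- by split.
- split.
  + have [M0 FM0] := F0; apply: submodI => [|a u v [M1 FM1 Mu] [M2 FM2 Mv]].
      have [subM0 _ _] := FP _ FM0; exists M0 => //.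
      by have [] := submod_props subM0.
    have [M [FM Mu' Mv']] : exists M, [/\ F M, M u & M v].
      case: (Ftot _ _ FM1 FM2) => M12; [exists M2|exists M1];
        by split=> //; apply: M12.
    have [subM _ _] := FP _ FM; exists M => //.
    by have [_ MD MZ] := submod_props subM; apply: MD => //; apply: MZ.
  + by apply: real_chain => // M /FP[].
  + by move=> [M /FP[_ _ nMf]].
have maxM Q : is_submodule Q -> is_real Q -> ~ Q f -> M `<=` Q -> Q `<=` M.
  by move=> subQ realQ nQf; apply: Mmax.
have [[phi u] [[phi_iota zM] /eqP]] :=
  separation A_fin_gen subM realM nMf maxM.
by apply; apply: (zf (phi, u)); split=> // g Ng; apply: zM; apply: PM; apply: NP.
Qed.
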